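(* For every $0<\lambda_1<\lambda_2<\infty$ there exist positive constants $c_1$ and $c_2$ such that for all $n\ge0$ and all $\lambda\in[\lambda_1,\lambda_2]$, $$c_1e^{-\xi(\lambda)n}\le q_n\le c_2e^{-\xi(\lambda)n}.$$ (In particular $c_1,c_2$ do not depend on $\lambda\in[\lambda_1,\lambda_2]$.)
   Context: Cylinder and walk. Let $d,L\ge1$ be integers, $\mathbb T=(\mathbb Z/L\mathbb Z)^{d-1}$, $G=\mathbb Z\times\mathbb T$ with nearest-neighbour graph structure. For $z=(i,y)\in G$ write $|z|=i$ (the level of $z$), and $G_j=\{z:|z|\le j\}$. Fix $1/2<p<1$. The random walk jumps from $z$ to $z+(1,0)$ with probability $p/d$, to $z-(1,0)$ with probability $(1-p)/d$, and to $z+(0,e)$ with probability $1/(2d)$ for each of the $2(d-1)$ unit vectors $e=\pm e_i$ of the torus. Paths. $\mathcal X_i$ is the set of finite nearest-neighbour paths starting on level $i-1$ and ending when first reaching level $i$. $\mathcal A_n$ is the set of half-infinite concatenations $\overline\gamma_n=\dots\gamma_{n-1}\gamma_n$ with $\gamma_j\in\mathcal X_j$, the endpoint of $\gamma_j$ being the starting point of $\gamma_{j+1}$; $\mathcal A=\mathcal A_0$. Paths are identified with their sets of visited sites when intersections are taken. Nice paths. For $\overline\gamma_0\in\mathcal A$, $D(\overline\gamma_0)$ is the connected component of $G_0\setminus\overline\gamma_0$ connecting level $0$ to $-\infty$ (empty if there is none), and $D_j$ is the set of sites of $D(\overline\gamma_0)$ on level $j$. $\overline\gamma_0$ is nice if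 $D(\overline\gamma_0)\ne\emptyset$ and for all $n\ge0$ there is $k>n$ with $\sum_{j=-k}^{-1}1\{D_j\text{ is connected}\}\ge n$. $\overline{\mathcal A}$ is the set of nice paths ($d,L$ are such that nice paths exist). Exponent. Given $\overline\gamma_0\in\overline{\mathcal A}$, attach to its endpoint an independent walk run until it first reaches level $n$, giving $\overline\gamma_n\in\mathcal A_n$; $\mathbf E^{\overline\gamma_0}$ is expectation over this walk. With $S$ another independent walk started at $x$ under $\mathbf P_1^x$, $T_r=\inf\{t:|S_t|=r\}$, $$Z_n=\lim_{x\in D(\overline\gamma_0),\,|x|\to-\infty}\mathbf P_1^x\{S[0,T_n]\cap\overline\gamma_n=\emptyset\mid S[0,T_0]\cap\overline\gamma_0=\emptyset\}.$$ For $\lambda>0$ put $q_n=q_n(\lambda)=\sup_{\overline\gamma_0\in\overline{\mathcal A}}\mathbf E^{\overline\gamma_0}[Z_n^\lambda]$ and $\xi(\lambda)=\xi(1,\lambda)=-\lim_{n\to\infty}\frac1n\log q_n$ (the limit exists and is finite). *)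

(* Defs.v *)
From HB Require Import structures.
From mathcomp Require Import all_boot all_order all_algebra.
From mathcomp Require Import all_classical all_reals all_analysis.

Set Implicit Arguments.
Unset Strict Implicit.
Unset Printing Implicit Defensive.

Import Order.TTheory GRing.Theory Num.Theory.
Import numFieldNormedType.Exports.

Local Open Scope classical_set_scope.
Local Open Scope ring_scope.

(* Z/LZ is represented by 'I_L with the cyclic successor [ordS] and predecessor
   [ord_pred]; unlike 'Z_L this is also correct for L = 1. *)
Definition torus (d L : nat) := {ffun 'I_d.-1 -> 'I_L}.
Definition vertex (d L : nat) : choiceType := (int * torus d L)%type.

Section Graph.
Variables d L : nat.
Implicit Types (z w : vertex d L) (i : 'I_d.-1).

Definition level z : int := z.1.

Definition step_up z : vertex d L := (z.1 + 1, z.2).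
Definition step_down z : vertex d L := (z.1 - 1, z.2).
Definition step_plus i z : vertex d L :=
  (z.1, [ffun j => if j == i then ordS (z.2 j) else z.2 j]).
Definition step_minus i z : vertex d L :=
  (z.1, [ffun j => if j == i then ord_pred (z.2 j) else z.2 j]).

Definition adj z w : bool :=
  [|| w == step_up z, w == step_down z
    | [exists i, (w == step_plus i z) || (w == step_minus i z)]].

Definition joined (A : set (vertex d L)) z w : Prop :=
  exists s : seq (vertex d L),
    [/\ path adj z s, last z s = w & forall v, v \in z :: s -> A v].

Definition graph_connected (A : set (vertex d L)) : Prop :=
  forall z w, A z -> A w -> joined A z w.

(* The nonempty sequence of sites of a path, split into first site and rest. *)
Definition fpath := (vertex d L * seq (vertex d L))%type.
Definition fstart (g : fpath) : vertex d L := g.1.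
Definition fend (g : fpath) : vertex d L := last g.1 g.2.
Definition fsites (g : fpath) : seq (vertex d L) := g.1 :: g.2.

(* [belast] lists all the sites of the path but the final one. *)
Definition calX (i : int) : set fpath :=
  [set g | [/\ path adj g.1 g.2, level (fstart g) = i - 1, level (fend g) = i
             & forall v, v \in belast g.1 g.2 -> level v != i]].

(* A half-infinite path is given by its pieces; only those with index at most n
   are relevant. *)
Definition calA (n : int) : set (int -> fpath) :=
  [set g | (forall j, j <= n -> calX j (g j)) /\
           (forall j, j < n -> fend (g j) = fstart (g (j + 1)))].

Definition trace (n : int) (g : int -> fpath) : set (vertex d L) :=
  [set v | exists2 j, j <= n & v \in fsites (g j)].

Definition free_sites (g : int -> fpath) : set (vertex d L) :=
  [set v | level v <= 0] `\` trace 0 g.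

(* The component connecting level 0 to -oo.  It is unique: the path occupies a
   single site of level 0, and the rest of that level is connected. *)
Definition Dset (g : int -> fpath) : set (vertex d L) :=
  [set z | (exists w, level w = 0 /\ joined (free_sites g) z w) /\
           (forall m : int,
              exists w, level w <= m /\ joined (free_sites g) z w)].

Definition Dlevel (g : int -> fpath) (j : int) : set (vertex d L) :=
  [set z | Dset g z /\ level z = j].

Definition nice : set (int -> fpath) :=
  [set g | [/\ calA 0 g, Dset g !=set0
    & forall n : nat, exists2 k : nat, (n < k)%N &
        (n <= \sum_(1 <= j < k.+1)
                `[< graph_connected (Dlevel g (- j%:Z)) >])%N]].

(* The filter "x in D, |x| -> -oo". *)
Definition D_to_ninfty (g : int -> fpath) : set_system (vertex d L) :=
  filter_from [set: int] (fun m => [set x | Dset g x /\ level x <= m]).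

End Graph.

(* The sum over torus directions counts the 2(d-1) unit vectors separately even
   when some of them lead to the same neighbour (L <= 2). *)
Definition trans (R : realType) (d L : nat) (p : R) (z w : vertex d L) : R :=
  p / d%:R * (w == step_up z)%:R + (1 - p) / d%:R * (w == step_down z)%:R
  + \sum_(i < d.-1) (2 * d%:R)^-1 *
      ((w == step_plus i z)%:R + (w == step_minus i z)%:R).

(* A realization of the random walk: a process [walk_pos] and, for every x, a
   probability [walk_prob x] under which it is the walk started at x. *)
Record random_walk (R : realType) (d L : nat) (p : R) := RandomWalk {
  walk_display : measure_display;
  walk_space : measurableType walk_display;
  walk_pos : nat -> walk_space -> vertex d L;
  walk_prob : vertex d L -> probability walk_space R;
  walk_measurable : forall (t : nat) (z : vertex d L),
    measurable [set omega | walk_pos t omega = z];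
  walk_law : forall (x : vertex d L) (n : nat) (z : nat -> vertex d L),
    walk_prob x
      [set omega | forall t : nat, (t <= n)%N -> walk_pos t omega = z t]
    = ((z 0%N == x)%:R * \prod_(t < n) trans p (z t) (z t.+1))%:E }.

Definition cond_prob (R : realType) (dp : measure_display)
    (T : measurableType dp) (P : probability T R) (A B : set T) : R :=
  fine (P (A `&` B)) / fine (P B).

Section Exponent.
Variables (R : realType) (d L : nat) (p : R).
Implicit Types (W : random_walk d L p) (g : int -> fpath d L).

(* S[0, T_r]: a time t satisfies t <= T_r iff |S_s| <> r for all s < t. *)
Definition stopped_range W (r : int) (omega : walk_space W) :
    set (vertex d L) :=
  [set z | exists2 t : nat, walk_pos t omega = z &
     forall s : nat, (s < t)%N -> level (walk_pos s omega) != r].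

Definition avoids W (r : int) (K : set (vertex d L)) : set (walk_space W) :=
  [set omega | stopped_range r omega `&` K = set0].

(* The sites visited by the extension of g, from its endpoint on level 0, by
   the walk W run until it first reaches level n. *)
Definition extended_trace W g (n : nat) (omega : walk_space W) :
    set (vertex d L) :=
  trace 0 g `|` stopped_range n%:Z omega.

(* W1 is the walk S, W the walk extending g; their independence is built in by
   keeping them on separate probability spaces. *)
Definition Z (W1 W : random_walk d L p) g (n : nat)
    (omega : walk_space W) : R :=
  lim (cond_prob (walk_prob W1 x)
         (avoids n%:Z (extended_trace g n omega)) (avoids 0 (trace 0 g))
       @[x --> D_to_ninfty g]).

Definition q (W1 W : random_walk d L p) (n : nat) (lambda : R) : \bar R :=
  ereal_sup [set 'E_(walk_prob W (fend (g 0%R)))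
                   [fun omega => (Z W1 g n omega `^ lambda)%R]%E
            | g in @nice d L].

Definition xi (W1 W : random_walk d L p) (lambda : R) : R :=
  - lim (n%:R^-1 * ln (fine (q W1 W n lambda)) @[n --> \oo]).

End Exponent.

(* Main.v *)
Require Import Defs.
From mathcomp Require Import all_boot all_order all_algebra.
From mathcomp Require Import all_classical all_reals all_analysis.
From mathcomp Require Import measurable_realfun.
From mathcomp Require Import ring lra zify.
Import Order.TTheory GRing.Theory Num.Theory.
Import numFieldNormedType.Exports.
Local Open Scope classical_set_scope.
Local Open Scope ring_scope.

Set Implicit Arguments.
Unset Strict Implicit.
Unset Printing Implicit Defensive.

(** The suprema [q n lam] are compared with quantities that involve no past.
    Let [moment n lam x] be the [lam]-th moment of the probability that two
    independent walks, started on a common level (the first one at [x]), climb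
    [n] levels without meeting and without ever coming back to the starting
    level; it is summed over the starting site of the second walk.

    By the upward drift the expected number of visits to a level is bounded
    ([green_level]).  Decomposing the two walks at their last visits to their
    starting level ([last_exit_le]), one may therefore forget what they did
    before, at the cost of a constant factor, since this only makes avoidance
    easier ([hit_moment_le]).  This gives [q n <= C * moment n] whatever the
    past ([q_le_moment]), and, cutting at height [n],
    [moment (n + m) <= C * moment n * moment m] ([moment_add_le]).

    Conversely, after climbing [n] levels the walks stand at different sites of
    a level.  The torus minus a point is connected ([torus_minus_point_ind]), so
    that at a bounded cost the second walk can step along this level, around the
    first one, to the best starting site for another duel ([sidestep]).  Hence
    [c * moment n * moment m <= moment (n + m)] for [n > 0] ([moment_add_ge]).

    The bound [c * moment n <= q n] asks for a single nice past.  The one chosen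
    ([thick_path]) fills every negative level except for one site, always in the
    same column; the conditioned walk can only come up that column, the
    conditional probability defining [Z n] does not depend on where it starts,
    and its limit is immediate ([Zpath_ge], [moment_le_q]).

    So [q] is multiplicative up to constants, which are uniform for bounded
    [lam], and its logarithm is almost additive; [almost_additive_lim] then
    keeps [ln (q n)] within a constant of [- xi * n].

    The passage from the walks to sums over finite trajectories rests on the
    fact that higher levels are almost surely hit ([prob_hits],
    [integral_stopped]). *)

(** * Sums of nonnegative families, and almost additive sequences *)

Section Esum.
Variable R : realType.
Local Open Scope ereal_scope.

Lemma le_esum_subset (T : choiceType) (A B : set T) (f : T -> \bar R) :
  A `<=` B -> \esum_(a in A) f a <= \esum_(a in B) f a.
Proof.
move=> AB; apply: ereal_sup_le => _ [X [finX XA] <-].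
by exists X => //; split=> // x /XA /AB.
Qed.

Lemma le_esum_sub (T : choiceType) (A B : set T) (f g : T -> \bar R) :
  A `<=` B -> (forall a, A a -> f a <= g a) ->
  \esum_(a in A) f a <= \esum_(a in B) g a.
Proof.
move=> AB fg; apply: le_trans (le_esum_subset _ AB).
exact: le_esum.
Qed.

Lemma esum_neq0 (T : choiceType) (A : set T) (f : T -> \bar R) :
  \esum_(a in A) f a = \esum_(a in A `&` [set a | f a != 0]) f a.
Proof.
rewrite esum_mkcondr; apply: eq_esum => a _; case: ifPn => // /negP fa.
by apply/eqP; apply: contra_notT fa => ?; rewrite inE.
Qed.

(** An upper bound by cutting: every index that contributes on the left has to
    be glued from a pair of pieces, but several pairs may give the same
    index. *)
Lemma esum_le_cover (T1 T2 T : choiceType) (A : set T) (I : set T1)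
    (J : T1 -> set T2) (h : T1 -> T2 -> T) (f : T -> \bar R)
    (g : T1 -> T2 -> \bar R) :
    (forall i j, I i -> J i j -> 0 <= g i j) ->
    (forall a, A a -> f a != 0 ->
       exists i j, [/\ I i, J i j, a = h i j & f a <= g i j]) ->
  \esum_(a in A) f a <= \esum_(i in I) \esum_(j in J i) g i j.
Proof.
move=> g0 cov'; rewrite esum_esum// esum_neq0.
have : forall a, (A `&` [set a | f a != 0]) a ->
    exists i j, [/\ I i, J i j, a = h i j & f a <= g i j].
  by move=> a [Aa fa]; exact: cov'.
move: (A `&` _) => {cov'}{}A cov.
have [A0|/set0P[a0 Aa0]] := eqVneq A set0.
  by rewrite A0 esum_set0 esum_ge0// => -[i j] [? ?]; exact: g0.
have [i0 [j0 _]] := cov _ Aa0.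
have /choice[e He] : forall a, exists k : T1 * T2, A a ->
    [/\ I k.1, J k.1 k.2, a = h k.1 k.2 & f a <= g k.1 k.2].
  move=> a; have [Aa|nAa] := pselect (A a); last by exists (i0, j0).
  by have [i [j H]] := cov _ Aa; exists (i, j).
apply: (@le_trans _ _ (\esum_(a in A) g (e a).1 (e a).2)).
  by apply: le_esum => a /He[].
rewrite -(esum_image A e (fun k => g k.1 k.2)).
  by apply: le_esum_subset => _ [a /He[? ? _ _] <-]; split.
move=> a a' /set_mem /He[_ _ Ea _] /set_mem /He[_ _ Ea' _] E.
by rewrite Ea Ea' E.
Qed.

(** The lower bound by gluing, for which distinct pairs must give distinct
    indices. *)
Lemma esum_ge_inj (T1 T2 T : choiceType) (A : set T) (I : set T1)
    (J : T1 -> set T2) (h : T1 -> T2 -> T) (f : T -> \bar R)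
    (g : T1 -> T2 -> \bar R) :
    (forall i j, I i -> J i j -> 0 <= g i j) ->
    (forall i j, I i -> J i j -> g i j != 0 ->
       A (h i j) /\ g i j <= f (h i j)) ->
    (forall i j i' j', I i -> J i j -> I i' -> J i' j' ->
       h i j = h i' j' -> i = i' /\ j = j') ->
  \esum_(i in I) \esum_(j in J i) g i j <= \esum_(a in A) f a.
Proof.
move=> g0 gf inj; rewrite esum_esum// esum_neq0.
set P := _ `&` _; apply: (@le_trans _ _ (\esum_(k in P) f (h k.1 k.2))).
  by apply: le_esum => -[i j] [[Ii Jj] gn]; have [] := gf i j Ii Jj gn.
rewrite -(esum_image P (fun k => h k.1 k.2) f).
  apply: le_esum_subset => _ [[i j] [[Ii Jj] gn] <-].
  by have [] := gf i j Ii Jj gn.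
move=> [i j] [i' j'] /set_mem[[Ii Jj] _] /set_mem[[Ii' Jj'] _] /= E.
by have [/= -> ->] := inj _ _ _ _ Ii Jj Ii' Jj' E.
Qed.

Lemma esumZl (T : choiceType) (A : set T) (f : T -> \bar R) (c : R) :
    (0 <= c)%R -> (forall a, 0 <= f a) ->
  \esum_(a in A) (c%:E * f a) = c%:E * \esum_(a in A) f a.
Proof.
have le (B : set T) (g : T -> \bar R) (k : R) : (0 <= k)%R ->
    (forall a, 0 <= g a) ->
    \esum_(a in B) (k%:E * g a) <= k%:E * \esum_(a in B) g a.
  move=> k0 g0; apply: ge_ereal_sup => /= _ [X [finX XB] <-].
  rewrite -ge0_mule_fsumr//; apply: lee_wpmul2l => //.
  by apply: ereal_sup_ubound; exists X.
move=> c0 f0; apply/eqP; rewrite eq_le le//=.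
have [->|cn0] := eqVneq c 0%R.
  by rewrite mul0e esum_ge0// => a _; rewrite mul0e.
have cp : (0 < c)%R by rewrite lt_neqAle eq_sym cn0.
rewrite -lee_pdivlMl//.
apply: le_trans (le _ _ _ _ _); rewrite ?invr_ge0//; last first.
  by move=> a; rewrite mule_ge0 ?lee_fin// f0.
by apply: le_esum => a Aa; rewrite muleA -EFinM mulVf// mul1e.
Qed.

(** Reduces a bound on a sum over trajectories to an induction on their
    length. *)
Lemma esum_le_exhaust (T : choiceType) (r : T -> nat) (A : set T)
    (f : T -> \bar R) (M : \bar R) :
    (forall t, \esum_(a in A `&` [set a | (r a <= t)%N]) f a <= M) ->
  \esum_(a in A) f a <= M.
Proof.
move=> H; apply: ge_ereal_sup => /= _ [X [finX XA] <-].
have [s Xs] : exists s : seq T, X = [set` s] by exact/finite_seqP.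
apply: le_trans (H (\max_(a <- s) r a)%N).
apply: ereal_sup_ubound; exists X => //.
split=> // a Xa; split; first exact: XA.
by apply: leq_bigmax_seq => //; move: Xa; rewrite Xs.
Qed.

End Esum.

Section AlmostAdditive.
Variables (R : realType) (u : nat -> R) (c : R).
Hypothesis uD : forall n m, (0 < n)%N -> (0 < m)%N ->
  `|u (n + m)%N - u n - u m| <= c.

Lemma almost_additive_muln (k n : nat) : (0 < n)%N ->
  `|u (k.+1 * n)%N - k.+1%:R * u n| <= k%:R * c.
Proof.
move=> n0; elim: k => [|k IH]; first by rewrite mul1n mul1r subrr normr0 mul0r.
rewrite mulSn.
have := uD n0 (_ : 0 < k.+1 * n)%N; rewrite muln_gt0 n0 => /(_ isT).
move: IH; rewrite -(natr1 k.+1) -(natr1 k) !ler_norml.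
by move=> /andP[? ?] /andP[? ?]; apply/andP; split; lra.
Qed.

Lemma almost_additive_ratio (k n : nat) : (0 < k)%N -> (0 < n)%N ->
  k%:R^-1 * u k - c / k%:R <= n%:R^-1 * u n + c / n%:R.
Proof.
have c0 : 0 <= c by exact: le_trans (uD (ltn0Sn 0) (ltn0Sn 0)).
case: k => // k _; case: n => // n _.
have := almost_additive_muln k (ltn0Sn n).
have := almost_additive_muln n (ltn0Sn k); rewrite (mulnC n.+1).
move: (u (k.+1 * n.+1)%N) (u k.+1) (u n.+1) => w x y.
rewrite -(natr1 k) -(natr1 n).
have k0 : 0 <= k%:R :> R by [].
have n0 : 0 <= n%:R :> R by [].
move: (k%:R) (n%:R) k0 n0 => a b a0 b0 /ler_normlP[H1 _] /ler_normlP[_ H2].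
rewrite [leLHS](_ : _ = (x - c) / (a + 1)); last by field; lra.
rewrite [leRHS](_ : _ = (y + c) / (b + 1)); last by field; lra.
rewrite ler_pdivrMr; last by lra.
rewrite mulrAC ler_pdivlMr; last by lra.
nra.
Qed.

(** The Hyers-Ulam form of Fekete's lemma: since [u k / k - c / k] never exceeds
    [u n / n + c / n], the supremum of the former quantities separates the two
    families, and it lies within [c / n] of every [u n / n]. *)
Lemma almost_additive_lim (n : nat) : (0 < n)%N ->
  `|u n - n%:R * lim (k%:R^-1 * u k @[k --> \oo])| <= c.
Proof.
have c0 : 0 <= c by exact: le_trans (uD (ltn0Sn 0) (ltn0Sn 0)).
pose A := [set k%:R^-1 * u k - c / k%:R | k in [set k | (0 < k)%N]].
have ubA m : (0 < m)%N -> ubound A (m%:R^-1 * u m + c / m%:R).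
  by move=> m0 _ [k k0 <-]; exact: almost_additive_ratio.
have A0 : A !=set0 by exists (1%:R^-1 * u 1%N - c / 1%:R), 1%N.
have supA : has_sup A by split=> //; eexists; exact: (ubA 1%N (ltn0Sn 0)).
have bnd m : (0 < m)%N -> `|m%:R^-1 * u m - sup A| <= c / m%:R.
  move=> m0; rewrite ler_distlC; apply/andP; split.
    by apply: ub_le_sup; [case: supA|exists m].
  by apply: ge_sup => //; exact: ubA.
have -> : lim (k%:R^-1 * u k @[k --> \oo]) = sup A.
  apply: cvg_lim => //; apply/cvgrPdist_le => e e0.
  near=> m; rewrite distrC; apply: le_trans (bnd m _) _.
    by near: m; exists 1%N.
  rewrite ler_pdivrMr; last by rewrite ltr0n; near: m; exists 1%N.
  rewrite -ler_pdivrMl// mulrC.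
  near: m; exact: nbhs_infty_ger.
move=> n0; have := bnd n n0.
have n0' : 0 < n%:R :> R by rewrite ltr0n.
rewrite ler_pdivlMr// -[X in _ * X]gtr0_norm// -normrM mulrBl.
by rewrite mulrAC mulVf ?gt_eqF// mul1r (mulrC (sup A)).
Unshelve. all: by end_near. Qed.

End AlmostAdditive.

(** * The weight of a finite trajectory *)

Section Paths.
Variables (R : realType) (d L : nat) (p : R).
Hypotheses (hd : (1 <= d)%N) (hp : 1 / 2 < p < 1).
Local Notation V := (vertex d L).
Implicit Types (x y z v w : V) (s : seq V).

Let d0 : 0 < d%:R :> R. Proof. by rewrite ltr0n. Qed.
Let p0 : 0 < p. Proof. by case/andP: hp => ? _; lra. Qed.
Let p1 : p < 1. Proof. by case/andP: hp. Qed.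

Let cup_ge0 : 0 <= p / d%:R. Proof. by rewrite divr_ge0 ?ler0n ?ltW. Qed.
Let cdown_ge0 : 0 <= (1 - p) / d%:R.
Proof. by rewrite divr_ge0 ?ler0n ?subr_ge0 ?ltW. Qed.
Let cside_ge0 : 0 <= (2 * d%:R)^-1 :> R.
Proof. by rewrite invr_ge0 mulr_ge0 ?ler0n. Qed.
Let side z w (i : 'I_d.-1) : 0 <= (2 * d%:R)^-1 *
  ((w == step_plus i z)%:R + (w == step_minus i z)%:R) :> R.
Proof. by rewrite mulr_ge0 ?addr_ge0. Qed.

Lemma trans_ge0 z w : 0 <= trans p z w.
Proof.
rewrite /trans !addr_ge0//; [exact: mulr_ge0|exact: mulr_ge0|].
by apply: sumr_ge0 => i _; exact: side.
Qed.

Lemma trans_step_up z : p / d%:R <= trans p z (step_up z).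
Proof.
rewrite /trans eqxx mulr1 -addrA lerDl addr_ge0//; first exact: mulr_ge0.
by apply: sumr_ge0 => i _; exact: side.
Qed.

Lemma trans_step_side z w (i : 'I_d.-1) :
  (w == step_plus i z) || (w == step_minus i z) ->
  (2 * d%:R)^-1 <= trans p z w.
Proof.
move=> wi; rewrite /trans (bigD1 i)//= addrCA.
rewrite ler_wpDr//; last first.
  rewrite -[leLHS]mulr1 ler_wpM2l//.
  by case/orP: wi => ->; rewrite ?lerDl ?lerDr.
rewrite !addr_ge0//; [exact: mulr_ge0|exact: mulr_ge0|].
by apply: sumr_ge0 => j _; exact: side.
Qed.

Definition mean_step (u : V -> R) z : R :=
  p / d%:R * u (step_up z) + (1 - p) / d%:R * u (step_down z)
  + \sum_(i < d.-1) (2 * d%:R)^-1 * (u (step_plus i z) + u (step_minus i z)).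

Lemma esum_trans (u : V -> R) z : (forall w, 0 <= u w) ->
  \esum_(w in [set: V]) (trans p z w * u w)%:E = (mean_step u z)%:E.
Proof.
move=> u0.
have pt (c : R) v : 0 <= c ->
    \esum_(w in [set: V]) (c * (w == v)%:R * u w)%:E = (c * u v)%:E.
  move=> c0; rewrite (_ : \esum_(w in _) _ = \esum_(w in [set v]) (c * u w)%:E).
    by rewrite esum_set1// lee_fin mulr_ge0.
  rewrite [RHS]esum_mkcond; apply: eq_esum => w _.
  have -> : (w \in [set v]) = (w == v) by apply/idP/eqP; rewrite inE.
  by case: eqVneq => [->|_]; rewrite ?mulr1// mulr0 mul0r.
have ge0 (c : R) v w : 0 <= c -> (0 <= (c * (w == v)%:R * u w)%:E)%E.
  by move=> c0; rewrite lee_fin !mulr_ge0 ?ler0n.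
transitivity (\esum_(w in [set: V])
    ((p / d%:R * (w == step_up z)%:R * u w)%:E +
     ((1 - p) / d%:R * (w == step_down z)%:R * u w)%:E +
     \sum_(i < d.-1) (((2 * d%:R)^-1 * (w == step_plus i z)%:R * u w)%:E +
        ((2 * d%:R)^-1 * (w == step_minus i z)%:R * u w)%:E))%E).
  apply: eq_esum => w _; rewrite /trans 2!mulrDl !EFinD mulr_suml -sumEFin.
  congr (_ + _)%E; apply: eq_bigr => i _.
  by rewrite -EFinD mulrDr mulrDl.
rewrite esumD => [|w _|w _]; first last.
- by apply: sume_ge0 => i _; rewrite adde_ge0 ?ge0.
- by rewrite adde_ge0 ?ge0.
rewrite esumD => [|w _|w _]; [|exact: ge0|exact: ge0].
rewrite esum_sum; last by move=> w i _ _; rewrite adde_ge0 ?ge0.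
rewrite !pt// /mean_step !EFinD -sumEFin; congr (_ + _)%E.
apply: eq_bigr => i _; rewrite esumD; try by move=> w _; exact: ge0.
by rewrite !pt// mulrDr EFinD.
Qed.

Lemma mean_step1 z : mean_step (fun=> 1) z = 1.
Proof.
rewrite /mean_step sumr_const card_ord !mulr1 -[X in _ + X]mulr_natr.
have -> : d.-1%:R = d%:R - 1 :> R by rewrite -subn1 natrB.
by field; rewrite gt_eqF.
Qed.

(** The probability that the walk started at [x] goes on with the sites of [s].
    Adjacency is not imposed on [s]: the weight vanishes when it fails. *)
Fixpoint wt x s : R := if s is z :: s' then trans p x z * wt z s' else 1.

Lemma wt_ge0 x s : 0 <= wt x s.
Proof. by elim: s x => //= z s IH x; rewrite mulr_ge0 ?trans_ge0. Qed.

Lemma wt_cat x s1 s2 : wt x (s1 ++ s2) = wt x s1 * wt (last x s1) s2.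
Proof. by elim: s1 x => [|z s1 IH] x /=; rewrite ?mul1r// IH mulrA. Qed.

(** A superharmonic function dominates its potential: killing the walk once it
    enters [E], the expected total of [c] along the walk is at most [u].  Both
    the finiteness of the Green function and the fact that stopped trajectories
    have total weight at most 1 are instances. *)
Lemma potential_le (E : pred V) (c u : V -> R) x :
    (forall v, 0 <= c v) -> (forall v, 0 <= u v) ->
    (forall v, c v + (if E v then 0 else mean_step u v) <= u v) ->
  (\esum_(s in [set s | all (predC E) (belast x s)])
     (wt x s * c (last x s))%:E <= (u x)%:E)%E.
Proof.
move=> c0 u0 cu; apply: (@esum_le_exhaust _ _ size) => t.
elim: t x => [|t IH] x.
  apply: (@le_trans _ _ (\esum_(s in [set [::]]) (wt x s * c (last x s))%:E)).
    by apply: le_esum_subset => -[|z s] [_ //=].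
  rewrite esum_set1 ?lee_fin ?mulr_ge0//= mul1r (le_trans _ (cu x))// lerDl.
  case: ifP => // _; rewrite -lee_fin -esum_trans//.
  by apply: esum_ge0 => w _; rewrite lee_fin mulr_ge0 ?trans_ge0.
rewrite (esumID [set [::]]); last first.
  by move=> s _; rewrite lee_fin mulr_ge0 ?wt_ge0.
apply: le_trans (_ : ((c x)%:E + (if E x then 0 else mean_step u x)%:E <= _)%E);
  last by rewrite -EFinD lee_fin.
apply: leeD.
  apply: (@le_trans _ _ (\esum_(s in [set [::]]) (wt x s * c (last x s))%:E)).
    by apply: le_esum_subset => s [].
  by rewrite esum_set1 ?lee_fin ?mulr_ge0//= mul1r.
apply: le_trans (esum_le_cover (I := [set z | ~~ E x])
  (J := fun z => [set s | all (predC E) (belast z s)]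
                 `&` [set s | (size s <= t)%N])
  (h := cons) (g := fun z s => (trans p x z * (wt z s * c (last z s)))%:E)
  _ _) _.
- by move=> z s _ _; rewrite lee_fin !mulr_ge0 ?trans_ge0 ?wt_ge0.
- move=> [|z s] [[/= As st]] // _ _; exists z, s; split => //=.
  + by case/andP: As.
  + by split => //=; case/andP: As.
  + by rewrite mulrA.
case: ifPn => Ex.
  by rewrite (_ : [set _ | _] = set0) ?esum_set0// -subset0 => z.
rewrite (_ : [set _ | _] = setT); last by apply/seteqP; split.
rewrite -esum_trans//; apply: le_esum => z _.
under eq_esum do rewrite EFinM.
rewrite esumZl ?trans_ge0//; last by move=> s; rewrite lee_fin mulr_ge0 ?wt_ge0.
by rewrite EFinM lee_wpmul2l ?lee_fin ?trans_ge0.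
Qed.

End Paths.

(** * Hitting a level, and the Green function *)

Section Trajectories.
Variables (R : realType) (d L : nat) (p : R).
Local Notation V := (vertex d L).
Implicit Types (x y z v w : V) (s : seq V) (K : set V) (n : nat) (m : int).
Local Notation wt := (wt p).

Fixpoint hit m x s : bool :=
  if s is z :: s' then (level x != m) && hit m z s' else level x == m.

Lemma hitE m x s : hit m x s =
  all (predC (fun v => level v == m)) (belast x s) && (level (last x s) == m).
Proof. by elim: s x => //= z s IH x; rewrite IH andbA. Qed.

Lemma hit_last m x s : hit m x s -> level (last x s) = m.
Proof. by rewrite hitE => /andP[_ /eqP]. Qed.

Lemma hit_prefix_inj m x s1 s2 s1' s2' : hit m x s1 -> hit m x s1' ->
  s1 ++ s2 = s1' ++ s2' -> s1 = s1' /\ s2 = s2'.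
Proof.
elim: s1 s1' x => [|z s1 IH] [|z' s1'] x //=.
- by move=> ->.
- by move=> /andP[/negP xm _] /xm.
- move=> /andP[_ h1] /andP[_ h1'] [zz' e]; rewrite -zz' in h1'.
  by have [-> ->] := IH _ _ h1 h1' e; rewrite zz'.
Qed.

Lemma trans_level z w : trans p z w != 0 -> level w <= level z + 1.
Proof.
apply: contraNT; rewrite -ltNge => zw; apply/eqP; rewrite /trans.
have ne v : level v <= level z + 1 -> (w == v) = false.
  by move=> vz; apply: contraTF zw => /eqP ->; rewrite -leNgt.
rewrite !ne /level //=; last by lia.
rewrite !mulr0 !add0r big1// => i _; rewrite !ne /level //=; try lia.
by rewrite addr0 mulr0.
Qed.

(** The walk cannot jump over a level on its way up. *)
Lemma wt_below m x s : wt x s != 0 -> level x < m ->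
  all (fun v => level v != m) s -> level (last x s) < m.
Proof.
elim: s x => //= z s IH x.
rewrite mulf_eq0 negb_or => /andP[/trans_level xz s0].
by move=> xm /andP[zm sm]; apply: IH => //; lia.
Qed.

(** The same fact read backwards: a trajectory that avoids level [m] and ends
    above it has been above it all along. *)
Lemma wt_above m x s : wt x s != 0 -> m < level (last x s) ->
  all (fun v => level v != m) s -> all (fun v => m < level v) s.
Proof.
elim: s x => //= z s IH x; rewrite mulf_eq0 negb_or => /andP[_ s0] sm /andP[zm].
move=> sa; have sb := IH z s0 sm sa; rewrite sb andbT.
case: s s0 sm sb {sa IH} => //= w s.
rewrite mulf_eq0 negb_or => /andP[/trans_level zw _] _ /andP[wm _].
by lia.
Qed.

Definition rise n x s :=
  hit (level x + n%:Z) x s && all (fun v => level x < level v) s.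

Lemma last_visit x s : exists s1 s2, [/\ s = s1 ++ s2,
  level (last x s1) = level x & all (fun v => level v != level x) s2].
Proof.
elim/last_ind: s => [|s z [s1 [s2 [-> e a]]]]; first by exists [::], [::].
have [zx|zx] := eqVneq (level z) (level x).
  by exists (rcons (s1 ++ s2) z), [::]; rewrite cats0 last_rcons.
by exists s1, (rcons s2 z); rewrite -rcons_cat all_rcons a zx.
Qed.

Lemma hit_cat m x s1 s2 : hit m x (s1 ++ s2) -> hit m (last x s1) s2.
Proof. by elim: s1 x => //= z s1 IH x /andP[_ /IH]. Qed.

Lemma last_exit n x s : wt x s != 0 -> hit (level x + n%:Z) x s ->
  exists s1 s2, [/\ s = s1 ++ s2, level (last x s1) = level x
                  & rise n (last x s1) s2].
Proof.
move=> s0 hs; have [n0|n0] := posnP n.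
  exists [::], s; split => //; rewrite /rise /= hs /=.
  by case: s s0 hs => //= z s _; rewrite n0 addr0 eqxx.
have [s1 [s2 [e e1 a]]] := last_visit x s; exists s1, s2; split=> //.
move: s0 hs; rewrite e wt_cat mulf_eq0 negb_or => /andP[_ s20] /hit_cat hs.
rewrite /rise e1 hs /=; apply: wt_above s20 _ a.
by rewrite (hit_last hs) ltrDl ltz_nat.
Qed.

Lemma first_hit m x s : wt x s != 0 -> level x <= m -> m <= level (last x s) ->
  exists s1 s2, s = s1 ++ s2 /\ hit m x s1.
Proof.
elim: s x => [|z s IH] x /=.
  by move=> _ ? ?; exists [::], [::]; split=> //=; apply/eqP/le_anti/andP.
rewrite mulf_eq0 negb_or => /andP[/trans_level xz s0] xm ml.
have [xm'|xm'] := eqVneq (level x) m.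
  by exists [::], (z :: s); rewrite /= xm' eqxx.
have [|s1 [s2 [-> h]]] := IH z s0 _ ml; first by lia.
by exists (z :: s1), s2; rewrite /= xm'.
Qed.

Lemma hit_cat_avoid m x s1 s2 : all (fun v => level v != m) (x :: s1) ->
  hit m x (s1 ++ s2) = hit m (last x s1) s2.
Proof. by elim: s1 x => //= z s1 IH x /andP[-> zs]; rewrite IH. Qed.

Lemma hit_belast_lt m x s : wt x s != 0 -> level x <= m -> hit m x s ->
  all (fun v => level v < m) (belast x s).
Proof.
elim: s x => //= z s IH x.
rewrite mulf_eq0 negb_or => /andP[/trans_level xz s0].
by move=> xm /andP[xm' hz]; rewrite IH//; lia.
Qed.

Lemma hit_catI m m' x s1 s2 : wt x s1 != 0 -> level x <= m -> m <= m' ->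
  hit m x s1 -> hit m' (last x s1) s2 -> hit m' x (s1 ++ s2).
Proof.
move=> + + mm'; elim: s1 x => //= z s1 IH x; rewrite mulf_eq0 negb_or.
move=> /andP[/trans_level xz s0] xm /andP[xm' hz] h2.
by rewrite IH// ?andbT; lia.
Qed.

Fixpoint upline n x : seq V :=
  if n is n'.+1 then step_up x :: upline n' (step_up x) else [::].

Lemma hit_upline n x : hit (level x + n%:Z) x (upline n x).
Proof.
elim: n x => [|n IH] x /=; first by rewrite addr0.
have -> : level x + n.+1%:Z = level (step_up x) + n%:Z.
  by rewrite /level /=; lia.
by rewrite IH andbT /level /=; lia.
Qed.

Lemma mem_upline n x v :
  v \in upline n x -> v.2 = x.2 /\ level x < level v <= level x + n%:Z.
Proof.
elim: n x => //= n IH x; rewrite inE => /orP[/eqP ->|/IH[->]].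
  by rewrite /level /=; split=> //; lia.
by rewrite /level /= => H; split=> //; lia.
Qed.

Lemma rise_upline n x : rise n x (upline n x).
Proof.
rewrite /rise hit_upline; apply/allP => v /mem_upline[_ /andP[]//].
Qed.

End Trajectories.

Section Hitting.
Variables (R : realType) (d L : nat) (p : R).
Hypotheses (hd : (1 <= d)%N) (hp : 1 / 2 < p < 1).
Local Notation V := (vertex d L).
Implicit Types (x y z v w : V) (s : seq V) (K : set V) (n : nat) (m : int).
Local Notation wt := (wt p).

Let d0 : 0 < d%:R :> R. Proof. by rewrite ltr0n. Qed.
Let p0 : 0 < p. Proof. by case/andP: hp => ? _; lra. Qed.
Let ph : 1 / 2 < p. Proof. by case/andP: hp. Qed.

(** An upper bound [(1 - phi)^-1] for the Green function, where [phi] is the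
    factor by which one step multiplies the mean of [theta ^ level] when
    [theta = (2 p)^-1]. *)
Definition green : R := d%:R / (2 * (p - 1 / 2) ^+ 2).

Let ph2 : 0 < (p - 1 / 2) ^+ 2.
Proof. by rewrite exprn_gt0// subr_gt0. Qed.

Lemma green_gt0 : 0 < green.
Proof. by rewrite divr_gt0// mulr_gt0. Qed.

(* Every value strictly between (1 - p) / p and 1 would give phi < 1. *)
Let theta : R := (2 * p)^-1.
Let theta0 : 0 < theta. Proof. by rewrite invr_gt0 mulr_gt0. Qed.
Let theta1 : theta < 1.
Proof. by rewrite /theta invf_lt1 ?mulr_gt0//; move: ph; lra. Qed.
Let h v : R := theta ^ level v.
Let h0 v : 0 < h v. Proof. by rewrite exprz_gt0. Qed.

Let mean_step_h v : h v + mean_step p (fun w => green * h w) v = green * h v.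
Proof.
rewrite /mean_step /h /= /level /=.
have t0 : theta != 0 by rewrite gt_eqF.
rewrite !expfzDr// expr1z exprN1 sumr_const card_ord.
rewrite -[X in _ + (_ + X)]mulr_natr.
have -> : d.-1%:R = d%:R - 1 :> R by rewrite -subn1 natrB.
rewrite /green /theta; move: (_ ^ v.1) => c; field.
by rewrite !gt_eqF//= subr_gt0; move: ph; lra.
Qed.

Lemma esum_wt_exp x :
  (\esum_(s in [set: seq V]) (wt x s * h (last x s))%:E <= (green * h x)%:E)%E.
Proof.
have := @potential_le R d L p hp pred0 h (fun w => green * h w) x.
rewrite (_ : [set s | _] = setT).
  apply => [v|v|v /=]; last by rewrite mean_step_h.
    exact: ltW.
  by rewrite ltW// mulr_gt0// green_gt0.
by apply/seteqP; split=> s _ //=; apply/allP.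
Qed.

(** Each visit to the starting level contributes the same value of
    [theta ^ level], so that the potential of this function counts the
    visits. *)
Lemma green_level x :
  (\esum_(s in [set s | level (last x s) = level x]) (wt x s)%:E
     <= green%:E)%E.
Proof.
have hx := h0 x.
rewrite -(@lee_pmul2l _ (h x)%:E)//= -esumZl ?(ltW hx)//; last first.
  by move=> s; rewrite lee_fin wt_ge0.
rewrite -EFinM (mulrC (h x)); apply: le_trans (esum_wt_exp x).
apply: le_esum_sub => // s /= e; by rewrite -EFinM lee_fin /h e mulrC.
Qed.

Lemma mass_hit_le1 m x : (\esum_(s in [set s | hit m x s]) (wt x s)%:E <= 1)%E.
Proof.
pose E := fun v => level v == m.
have := @potential_le R d L p hp E (fun v => (E v)%:R) (fun=> 1) x.
move=> H; apply: le_trans (H _ _ _) => //; last first.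
  by move=> v; rewrite mean_step1//; case: (E v); rewrite /= ?addr0// add0r.
apply: (@le_trans _ _ (\esum_(s in [set s | hit m x s])
    (wt x s * (E (last x s))%:R)%:E)).
  apply: le_esum => s /= /hit_last e.
  by rewrite /E e eqxx mulr1.
by apply: le_esum_subset => s /=; rewrite hitE => /andP[].
Qed.

(** The trajectories of positive weight that have not hit level [m] end below
    it, where [theta ^ level] exceeds [theta ^ m]. *)
Lemma mass_never_hit m x : level x < m ->
  (\esum_(s in [set s | all (fun v => level v != m) s]) (wt x s)%:E
     <= (green * h x / theta ^ m)%:E)%E.
Proof.
move=> xm; have tm : 0 < theta ^ m by rewrite exprz_gt0.
rewrite mulrC EFinM -lee_pdivrMl ?invr_gt0// invrK.
rewrite -esumZl ?(ltW tm)//; last first.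
  by move=> s; rewrite lee_fin wt_ge0.
apply: le_trans (esum_wt_exp x).
apply: le_esum_sub => // s /= sm.
rewrite -EFinM lee_fin mulrC; have [->|s0] := eqVneq (wt x s) 0.
  by rewrite !mul0r.
rewrite ler_wpM2l ?wt_ge0//; have lm := wt_below s0 xm sm.
have -> : m = level (last x s) + `|m - level (last x s)|%N.
  by rewrite gez0_abs; lia.
rewrite expfzDr ?gt_eqF// /h ler_piMr ?exprz_ge0 ?(ltW theta0)//.
by rewrite -exprnP exprn_ile1 ?(ltW theta0) ?(ltW theta1).
Qed.

(** Decomposition at the last visit to the starting level; the Green function
    bounds the total weight of what precedes it. *)
Lemma last_exit_le n x (f : seq V -> R) (g : V -> seq V -> R) :
    (forall v s, 0 <= g v s) ->
    (forall s1 s2, level (last x s1) = level x -> rise n (last x s1) s2 ->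
       f (s1 ++ s2) <= g (last x s1) s2) ->
  (\esum_(s in [set s | hit (level x + n%:Z) x s]) (wt x s * f s)%:E <=
   green%:E * \sum_(t : torus d L) \esum_(s in [set s | rise n (level x, t) s])
     (wt (level x, t) s * g (level x, t) s)%:E)%E.
Proof.
move=> g0 fg; set M := (\sum_(t : _) _)%E.
have wg0 v s : (0 <= (wt v s * g v s)%:E)%E by rewrite lee_fin mulr_ge0 ?wt_ge0.
have M0 : (0 <= M)%E by apply: sume_ge0 => t _; apply: esum_ge0.
have [Moo|Mfin] := eqVneq M +oo%E.
  by rewrite Moo gt0_muley ?lte_fin ?green_gt0// leey.
have {}Mfin : M \is a fin_num by rewrite ge0_fin_numE// ltey.
apply: le_trans (esum_le_cover (I := [set s1 | level (last x s1) = level x])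
  (J := fun s1 => [set s2 | rise n (last x s1) s2]) (h := cat)
  (g := fun s1 s2 => ((wt x s1)%:E *
     (wt (last x s1) s2 * g (last x s1) s2)%:E)%E) _ _) _.
- by move=> s1 s2 _ _; rewrite mule_ge0 ?lee_fin ?mulr_ge0 ?wt_ge0.
- move=> s /= hs; rewrite eqe mulf_eq0 negb_or => /andP[s0 _].
  have [s1 [s2 [e e1 r]]] := last_exit s0 hs; exists s1, s2; split => //.
  by rewrite e wt_cat -EFinM mulrA lee_fin ler_wpM2l ?mulr_ge0 ?wt_ge0// fg.
apply: (@le_trans _ _ (\esum_(s1 in [set s1 | level (last x s1) = level x])
    (M * (wt x s1)%:E)%E)).
  apply: le_esum => s1 /= e1; rewrite esumZl ?wt_ge0// muleC.
  rewrite lee_wpmul2r ?lee_fin ?wt_ge0//.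
  have -> : last x s1 = (level x, (last x s1).2).
    by rewrite -e1 /level -surjective_pairing.
  rewrite /M (bigD1 (last x s1).2)//= leeDl// sume_ge0// => t _.
  exact: esum_ge0.
rewrite -(fineK Mfin) esumZl ?fine_ge0//; last first.
  by move=> s; rewrite lee_fin wt_ge0.
by rewrite muleC lee_wpmul2r ?lee_fin ?fine_ge0// green_level.
Qed.

End Hitting.

(** * Probability of avoiding a set *)

Section Uplines.
Variables (R : realType) (d L : nat) (p : R).
Hypotheses (hd : (1 <= d)%N) (hp : 1 / 2 < p < 1).

Lemma wt_upline_gt0 n (x : vertex d L) : 0 < wt p x (upline n x).
Proof.
elim: n x => //= n IH x.
rewrite mulr_gt0// (lt_le_trans _ (trans_step_up hp x))//.
by rewrite divr_gt0 ?ltr0n//; case/andP: hp => ? _; lra.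
Qed.

End Uplines.

Section Masses.
Variables (R : realType) (d L : nat) (p : R).
Hypotheses (hd : (1 <= d)%N) (hp : 1 / 2 < p < 1).
Local Notation V := (vertex d L).
Implicit Types (x y z v w : V) (s : seq V) (K : set V) (n : nat) (m : int)
  (S : pred (seq V)).
Local Notation wt := (wt p).

Definition ind K s : R := `[< forall v, v \in s -> ~ K v >]%:R.

Lemma ind_ge0 K s : 0 <= ind K s. Proof. exact: ler0n. Qed.

Lemma ind_le1 K s : ind K s <= 1.
Proof. by rewrite /ind; case: asbool. Qed.

Lemma ind_eq1 K s : (forall v, v \in s -> ~ K v) -> ind K s = 1.
Proof. by move=> H; rewrite /ind asboolT. Qed.

Lemma ind_neq0 K s : ind K s != 0 -> forall v, v \in s -> ~ K v.
Proof. by rewrite /ind; case: asboolP => //; rewrite eqxx. Qed.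

Lemma ind_sub K1 K2 s1 s2 :
  (forall v, v \in s2 -> K2 v -> v \in s1 /\ K1 v) -> ind K1 s1 <= ind K2 s2.
Proof.
move=> H; have [->|/ind_neq0 K1s] := eqVneq (ind K1 s1) 0; first exact: ind_ge0.
by rewrite (@ind_eq1 K2) ?ind_le1// => v vs /(H _ vs)[/K1s].
Qed.

Lemma ind_cat K s1 s2 : ind K (s1 ++ s2) = ind K s1 * ind K s2.
Proof.
rewrite /ind -natrM mulnb; congr (_%:R); congr nat_of_bool.
apply/asboolP/andP => [H|[/asboolP H1 /asboolP H2] v].
  by split; apply/asboolP => v vs; apply: H; rewrite mem_cat vs ?orbT.
by rewrite mem_cat => /orP[/H1|/H2].
Qed.

(** The total weight of the trajectories of the class [S] from [y] that avoid
    [K]: the probability that the walk started at [y] does so when the members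
    of [S] are stopped trajectories. *)
Definition mass S y K : R :=
  fine (\esum_(s in [set s | S s]) (wt y s * ind K (y :: s))%:E)%E.

Let term_ge0 y K s : (0 <= (wt y s * ind K (y :: s))%:E)%E.
Proof. by rewrite lee_fin mulr_ge0 ?wt_ge0 ?ind_ge0. Qed.

Lemma mass_ge0 S y K : 0 <= mass S y K.
Proof. by apply: fine_ge0; apply: esum_ge0 => s _; exact: term_ge0. Qed.

Let esum_mass_le1 S y K m : (forall s, S s -> hit m y s) ->
  (\esum_(s in [set s | S s]) (wt y s * ind K (y :: s))%:E <= 1)%E.
Proof.
move=> Sm; apply: le_trans (mass_hit_le1 hd hp m y).
apply: le_esum_sub => [s /Sm//|s _].
by rewrite lee_fin ler_piMr ?wt_ge0 ?ind_le1.
Qed.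

Lemma massE S y K m : (forall s, S s -> hit m y s) -> (mass S y K)%:E =
  \esum_(s in [set s | S s]) (wt y s * ind K (y :: s))%:E.
Proof.
move=> Sm; rewrite /mass fineK// ge0_fin_numE.
  by apply: le_lt_trans (esum_mass_le1 _ Sm) _; rewrite ltry.
by apply: esum_ge0 => s _; exact: term_ge0.
Qed.

Lemma mass_le1 S y K m : (forall s, S s -> hit m y s) -> mass S y K <= 1.
Proof. by move=> Sm; rewrite -lee_fin (massE _ Sm) (esum_mass_le1 _ Sm). Qed.

Lemma mass_ge_term S y K m s : (forall s, S s -> hit m y s) -> S s ->
  wt y s * ind K (y :: s) <= mass S y K.
Proof.
move=> Sm Ss; rewrite -lee_fin (massE _ Sm).
rewrite -(@esum_set1 R _ s (fun s => (wt y s * ind K (y :: s))%:E))//.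
by apply: le_esum_subset => _ ->.
Qed.

Lemma mass_le S1 S2 y K1 K2 m : (forall s, S2 s -> hit m y s) ->
    (forall s, S1 s -> S2 s) ->
    (forall s, S1 s -> ind K1 (y :: s) <= ind K2 (y :: s)) ->
  mass S1 y K1 <= mass S2 y K2.
Proof.
move=> S2m S12 K12; rewrite -lee_fin (massE _ S2m) (@massE _ _ _ m); last first.
  by move=> s /S12 /S2m.
by apply: le_esum_sub => // s Ss; rewrite lee_fin ler_wpM2l ?wt_ge0// K12.
Qed.

Lemma mass_le_sub S y K1 K2 m : (forall s, S s -> hit m y s) ->
  K2 `<=` K1 -> mass S y K1 <= mass S y K2.
Proof.
by move=> Sm K21; apply: (mass_le Sm) => // s _; apply: ind_sub => v ? /K21.
Qed.

(** The Markov property at the first visit to the level [m1], as an upper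
    bound. *)
Lemma mass_split_le m m1 y S S1 K K1 K2 (M : R) :
    (forall s, S s -> hit m y s) -> (forall s, S1 s -> hit m1 y s) ->
    (forall s1 s2, S (s1 ++ s2) -> hit m1 y s1 -> S1 s1) ->
    level y <= m1 <= m ->
    (forall s1, S1 s1 -> wt y s1 != 0 ->
       ind K (y :: s1) <= ind K1 (y :: s1)) ->
    K2 `<=` K -> 0 <= M ->
    (forall s1, S1 s1 -> wt y s1 != 0 -> ind K1 (y :: s1) != 0 ->
       mass (hit m (last y s1)) (last y s1) K2 <= M) ->
  mass S y K <= mass S1 y K1 * M.
Proof.
move=> Sm S1m SS1 /andP[ym mm] KK1 K2K M0 HM.
rewrite -lee_fin EFinM (massE _ Sm) (massE _ S1m) muleC.
apply: le_trans (esum_le_cover (I := [set s1 | S1 s1])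
  (J := fun s1 => [set s2 | hit m (last y s1) s2]) (h := cat)
  (g := fun s1 s2 => ((wt y s1 * ind K1 (y :: s1))%:E *
     (wt (last y s1) s2 * ind K2 (last y s1 :: s2))%:E)%E) _ _) _.
- by move=> s1 s2 _ _; rewrite mule_ge0.
- move=> s /= Ss; rewrite eqe mulf_eq0 negb_or => /andP[s0 _].
  have [|s1 [s2 [e h1]]] := first_hit s0 ym.
    by rewrite (hit_last (Sm _ Ss)).
  rewrite e in Ss *; exists s1, s2; split => //.
  - exact: SS1 Ss h1.
  - exact: hit_cat (Sm _ Ss).
  rewrite -EFinM lee_fin wt_cat [leRHS]mulrACA ler_wpM2l ?mulr_ge0 ?wt_ge0//.
  rewrite -cat_cons; have S1s := SS1 _ _ Ss h1.
  rewrite e wt_cat mulf_eq0 negb_or in s0; case/andP: s0 => s10 _.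
  apply: le_trans (_ : ind K (y :: s1) * ind K2 (last y s1 :: s2) <= _).
    have -> : y :: s1 = belast y s1 ++ [:: last y s1].
      by rewrite cats1 -lastI.
    rewrite -catA /= !ind_cat -mulrA ler_wpM2l ?ind_ge0//.
    rewrite -(cat1s _ s2) ind_cat.
    have [->|/ind_neq0 i1] := eqVneq (ind K [:: last y s1]) 0.
      by rewrite !mul0r.
    rewrite (@ind_eq1 K)// !mul1r -[leLHS]mul1r -(@ind_eq1 K [:: last y s1])//.
    rewrite -ind_cat; apply: ind_sub => v vs /K2K Kv; split=> //.
  by rewrite ler_wpM2r ?ind_ge0// KK1.
rewrite -esumZl//; apply: le_esum => s1 /= Ss1; rewrite esumZl//; last first.
  by rewrite mulr_ge0 ?wt_ge0 ?ind_ge0.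
rewrite -(@massE (hit m (last y s1)) _ _ m)// -!EFinM lee_fin mulrC.
have [->|c0] := eqVneq (wt y s1 * ind K1 (y :: s1)) 0; first by rewrite !mulr0.
rewrite ler_wpM2r ?mulr_ge0 ?wt_ge0 ?ind_ge0//.
by move: c0; rewrite mulf_eq0 negb_or => /andP[? ?]; exact: HM.
Qed.

(** The converse bound, for a continuation that succeeds with mass at least
    [c]. *)
Lemma mass_split_ge m m1 y S S1 (S2 : V -> pred (seq V)) K K1 (c : R) :
    (forall s, S s -> hit m y s) -> (forall s, S1 s -> hit m1 y s) ->
    (forall v s, S2 v s -> hit m v s) ->
    (forall s1 s2, S1 s1 -> wt y s1 != 0 -> S2 (last y s1) s2 ->
       S (s1 ++ s2)) ->
    (forall s1, S1 s1 -> wt y s1 != 0 ->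
       ind K1 (y :: s1) <= ind K (y :: s1)) -> 0 <= c ->
    (forall s1, S1 s1 -> wt y s1 != 0 -> ind K1 (y :: s1) != 0 ->
       c <= mass (S2 (last y s1)) (last y s1) K) ->
  mass S1 y K1 * c <= mass S y K.
Proof.
move=> Sm S1m S2m S12 K1K c0 Hc.
rewrite -lee_fin EFinM (massE _ Sm) (massE _ S1m) muleC -esumZl//.
apply: le_trans (esum_ge_inj (I := [set s1 | S1 s1])
  (J := fun s1 => [set s2 | S2 (last y s1) s2]) (h := cat)
  (g := fun s1 s2 => ((wt y s1 * ind K1 (y :: s1))%:E *
     (wt (last y s1) s2 * ind K (last y s1 :: s2))%:E)%E) _ _ _).
- apply: le_esum => s1 /= Ss1; rewrite esumZl//; last first.
    by rewrite mulr_ge0 ?wt_ge0 ?ind_ge0.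
  rewrite -(massE _ (S2m (last y s1))) -!EFinM lee_fin mulrC.
  have [->|c1] := eqVneq (wt y s1 * ind K1 (y :: s1)) 0.
    by rewrite !mul0r.
  rewrite ler_wpM2l ?mulr_ge0 ?wt_ge0 ?ind_ge0//.
  by move: c1; rewrite mulf_eq0 negb_or => /andP[? ?]; exact: Hc.
- by move=> s1 s2 _ _; rewrite mule_ge0.
- move=> s1 s2 /= Ss1 Ss2; rewrite !mule_eq0 !negb_or => /andP[].
  rewrite eqe mulf_eq0 negb_or => /andP[s10 _] _; split; first exact: S12.
  rewrite /= -EFinM lee_fin wt_cat mulrACA ler_wpM2l ?mulr_ge0 ?wt_ge0//.
  rewrite -cat_cons ind_cat ler_pM ?ind_ge0 ?K1K//.
  by apply: ind_sub => v vs Kv; rewrite inE vs orbT.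
- move=> s1 s2 s1' s2' /= /S1m h1 _ /S1m h1' _.
  exact: (hit_prefix_inj h1 h1').
Qed.

End Masses.

Opaque mass.

(** * Connectivity of the torus *)

Section Torus.
Variables (d L : nat).
Local Notation T := (torus d L).
Local Notation V := (vertex d L).
Implicit Types (t u : T) (i : 'I_d.-1).

Definition turn i t : T := [ffun j => if j == i then ordS (t j) else t j].
Definition turn_back i t : T :=
  [ffun j => if j == i then ord_pred (t j) else t j].
Definition set_coord i (a : 'I_L) t : T :=
  [ffun j => if j == i then a else t j].

Lemma turnK i : cancel (turn i) (turn_back i).
Proof.
by move=> t; apply/ffunP => j; rewrite !ffunE; case: eqP => // _; rewrite ordSK.
Qed.

Lemma turn_backK i : cancel (turn_back i) (turn i).
Proof.
move=> t; apply/ffunP => j; rewrite !ffunE; case: eqP => // _.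
by rewrite ord_predK.
Qed.

Lemma turnC i j t : turn i (turn j t) = turn j (turn i t).
Proof. by apply/ffunP => k; rewrite !ffunE; do 2 case: eqP. Qed.

Lemma turn_turn_back i j t : turn i (turn_back j t) = turn_back j (turn i t).
Proof.
apply/ffunP => k; rewrite !ffunE; do 2 case: eqP => // _.
by rewrite ordSK ord_predK.
Qed.

Lemma iter_ordS (a : 'I_L) m : iter m (@ordS L) a = ((a + m) %% L)%N :> nat.
Proof.
elim: m => [|m IH]; first by rewrite addn0 modn_small.
by rewrite iterS /= IH -addn1 modnDml addn1 addnS.
Qed.

Lemma circle_ind (Q : 'I_L -> Prop) (a b : 'I_L) :
  (forall c, Q c -> Q (ordS c)) -> Q a -> Q b.
Proof.
move=> QS Qa; have <- : iter (b + (L - a)) (@ordS L) a = b.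
  apply/ord_inj; rewrite iter_ordS.
  rewrite (_ : (a + (b + (L - a)) = b + L)%N); last first.
    by have := ltn_ord a; lia.
  by rewrite modnDr modn_small.
by elim: (_ + _)%N => //= m; exact: QS.
Qed.

(** Removing the point [c] from a circle leaves the arc swept from [ordS c]
    upwards: one goes down to [ordS c] first, then up to the target. *)
Lemma circle_minus_point_ind (c : 'I_L) (Q : 'I_L -> Prop) (a b : 'I_L) :
  (forall e, e != c -> ordS e != c -> Q e -> Q (ordS e)) ->
  (forall e, e != c -> ord_pred e != c -> Q e -> Q (ord_pred e)) ->
  a != c -> b != c -> Q a -> Q b.
Proof.
move=> QS QP ac bc Qa.
pose e m := iter m (@ordS L) c.
have en m : (0 < m < L)%N -> e m != c.
  move=> /andP[m0 mL]; apply/eqP => /(congr1 (@nat_of_ord L)).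
  rewrite iter_ordS.
  have cL := ltn_ord c; have [cm|cm] := ltnP (c + m) L.
    by rewrite modn_small//; lia.
  rewrite -(subnKC cm) modnDl modn_small; lia.
have rep f : f != c -> exists2 m, (0 < m < L)%N & f = e m.
  move=> fc; have cL := ltn_ord c; have fL := ltn_ord f.
  have fc' : (f != c :> nat) by [].
  exists (if (c < f)%N then f - c else f + L - c)%N.
    by case: ifP; lia.
  apply/ord_inj; rewrite iter_ordS; case: ifP => cf.
    by rewrite subnKC ?modn_small//; lia.
  by rewrite subnKC ?modnDr ?modn_small//; lia.
have [m mL Ea] := rep a ac; have [k kL Eb] := rep b bc.
have down j : (0 < j < L)%N -> Q (e j) -> Q (e 1%N).
  elim: j => // -[//|j] IH jL Qj; apply: IH; first by lia.
  rewrite -(ordSK (e j.+1)); apply: QP => //; first exact: (en j.+2).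
  by rewrite ordSK en//; lia.
have up j : (0 < j < L)%N -> Q (e 1%N) -> Q (e j).
  elim: j => // -[//|j] IH jL Q1; apply: QS; [|exact: (en j.+2)|].
    by apply: (en j.+1); lia.
  by apply: IH => //; lia.
by rewrite Eb; apply: up => //; apply: down mL _; rewrite -Ea.
Qed.

Lemma set_coord_id i t : set_coord i (t i) t = t.
Proof. by apply/ffunP => j; rewrite ffunE; case: eqP => [->|]. Qed.

Lemma turn_set_coord i a t : turn i (set_coord i a t) = set_coord i (ordS a) t.
Proof. by apply/ffunP => j; rewrite !ffunE; case: eqP. Qed.

Lemma turn_back_set_coord i a t :
  turn_back i (set_coord i a t) = set_coord i (ord_pred a) t.
Proof. by apply/ffunP => j; rewrite !ffunE; case: eqP. Qed.

(* The coordinates listed in [r] are moved to their targets one at a time. *)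
Lemma set_coords_ind (P : T -> Prop) (r : seq 'I_d.-1) t u :
    (forall i (v : T), i \in r -> (forall k, k \notin r -> v k = t k) ->
       P v -> P (set_coord i (u i) v)) ->
  P t -> P [ffun j => if j \in r then u j else t j].
Proof.
elim: r => [|i r IH] HP Pt.
  by rewrite (_ : finfun _ = t)//; apply/ffunP => j; rewrite ffunE.
have := HP i [ffun j => if j \in r then u j else t j].
rewrite (_ : set_coord _ _ _ = [ffun j => if j \in i :: r then u j else t j]).
  apply; first exact: mem_head.
    by move=> k; rewrite inE negb_or ffunE => /andP[_ /negPf ->].
  apply: IH => // j v jr vt; apply: HP; first by rewrite inE jr orbT.
  by move=> k; rewrite inE negb_or => /andP[_ /vt].
by apply/ffunP => j; rewrite !ffunE inE; case: eqP => [->|].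
Qed.

Lemma torus_ind (P : T -> Prop) t u :
  (forall i v, P v -> P (turn i v)) -> P t -> P u.
Proof.
move=> Pturn Pt.
have -> : u = [ffun j => if j \in enum 'I_d.-1 then u j else t j].
  by apply/ffunP => j; rewrite ffunE mem_enum.
apply: set_coords_ind => // i v _ _ Pv.
apply: (@circle_ind (fun a => P (set_coord i a v)) (v i)).
  by move=> c; rewrite -turn_set_coord; exact: Pturn.
by rewrite set_coord_id.
Qed.

(** The torus stays connected when a point [o] is removed: keep a coordinate
    that differs from [o] fixed while the others move to their targets, and
    move it last. Only when every other coordinate of the target agrees with
    [o] must that last move avoid a point of its circle. *)
Lemma torus_minus_point_ind (o : T) (P : T -> Prop) t u :
    (forall i v, v != o -> turn i v != o -> P v -> P (turn i v)) ->
    (forall i v, v != o -> turn_back i v != o -> P v -> P (turn_back i v)) ->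
  t != o -> u != o -> P t -> P u.
Proof.
move=> PS PB to uo Pt.
have neq (v : T) k : v k != o k -> v != o by apply: contraNneq => ->.
have ex (v : T) : v != o -> exists k, v k != o k.
  move=> vo; apply/existsP; rewrite -negb_forall; apply: contraNN vo.
  by move=> /forallP vo; apply/eqP/ffunP => k; apply/eqP.
have move1 i k (v : T) a : k != i -> v k != o k -> P v -> P (set_coord i a v).
  move=> ki vk Pv.
  have sk c : set_coord i c v != o.
    by apply: (neq _ k); rewrite ffunE (negPf ki).
  apply: (@circle_ind (fun c => P (set_coord i c v)) (v i)).
    by move=> c; rewrite -turn_set_coord; apply: PS; rewrite ?turn_set_coord.
  by rewrite set_coord_id.
have [k tk] := ex t to.
pose r := [seq i <- enum 'I_d.-1 | i != k].
have Pv : P [ffun j => if j \in r then u j else t j].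
  apply: set_coords_ind => // i v; rewrite mem_filter => /andP[ik _] vt Pv.
  apply: (move1 i k) => //; first by rewrite eq_sym.
  by rewrite vt// mem_filter eqxx.
set v := finfun _ in Pv.
have vE j : v j = if j != k then u j else t j.
  by rewrite ffunE mem_filter mem_enum andbT.
have uE : u = set_coord k (u k) v.
  by apply/ffunP => j; rewrite ffunE vE; case: eqVneq => [->|].
have [i ui] := ex u uo; have [ik|ik] := eqVneq i k; last first.
  by rewrite uE; apply: (move1 k i) => //; rewrite vE ik.
rewrite ik in ui; have vk : v k = t k by rewrite vE eqxx.
have sk c : c != o k -> set_coord k c v != o.
  by move=> ck; apply: (neq _ k); rewrite ffunE eqxx.
rewrite uE.
apply: (@circle_minus_point_ind (o k)
  (fun c => P (set_coord k c v)) (v k)) => //.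
- move=> e eo So; rewrite -turn_set_coord; apply: PS; first exact: sk.
  by rewrite turn_set_coord sk.
- move=> e eo So; rewrite -turn_back_set_coord; apply: PB; first exact: sk.
  by rewrite turn_back_set_coord sk.
- by rewrite vk.
- by rewrite set_coord_id.
Qed.

End Torus.

(** * Duels of two walks that do not come back *)

Section Moments.
Variables (R : realType) (d L : nat) (p : R).
Hypotheses (hd : (1 <= d)%N) (hp : 1 / 2 < p < 1).
Local Notation T := (torus d L).
Local Notation V := (vertex d L).
Implicit Types (x y z v w : V) (s : seq V) (K : set V) (n : nat) (m : int)
  (lam : R).
Local Notation wt := (wt p).
Local Notation mass := (mass p).
Local Notation ind := (@ind R d L).
Local Notation green := (green d p).

Definition rise_mass n y K := mass (rise n y) y K.

Lemma rise_hit n x s : rise n x s -> hit (level x + n%:Z) x s.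
Proof. by case/andP. Qed.

Lemma rise_massE n y K : (rise_mass n y K)%:E =
  \esum_(s in [set s | rise n y s]) (wt y s * ind K (y :: s))%:E.
Proof. exact: (massE hd hp K (@rise_hit n y)). Qed.

Lemma rise_mass_ge0 n y K : 0 <= rise_mass n y K.
Proof. exact: mass_ge0. Qed.

Lemma rise_mass_le1 n y K : rise_mass n y K <= 1.
Proof. by apply: (mass_le1 hd hp) => s /rise_hit; exact. Qed.

(** [duel n lam x y] is the expectation, over a walk from [x], of the [lam]-th
    power of the probability that an independent walk from [y] avoids it, both
    walks being required to climb [n] levels without coming back to their
    starting level; [moment] sums it over the starting points [y] on the level
    of [x]. Unlike the suprema of the theorem, these quantities do not involve
    any past and can be compared by cutting and gluing trajectories. *)
Definition duel n lam x y : \bar R :=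
  \esum_(s in [set s | rise n x s])
     (wt x s * rise_mass n y [set` x :: s] `^ lam)%:E.

Definition moment n lam x : \bar R :=
  (\sum_(t : T) duel n lam x (level x, t))%E.

Lemma momentE n lam x :
  moment n lam x = (\sum_(t : T) duel n lam x (level x, t))%E.
Proof. by []. Qed.

Let term_ge0 n lam x y s :
  (0 <= (wt x s * rise_mass n y [set` x :: s] `^ lam)%:E)%E.
Proof. by rewrite lee_fin mulr_ge0 ?wt_ge0 ?powR_ge0. Qed.

Lemma duel_ge0 n lam x y : (0 <= duel n lam x y)%E.
Proof. by apply: esum_ge0 => s _; exact: term_ge0. Qed.

Lemma moment_ge0 n lam x : (0 <= moment n lam x)%E.
Proof. by apply: sume_ge0 => t _; exact: duel_ge0. Qed.

Lemma duel_le1 n lam x y : 0 <= lam -> (duel n lam x y <= 1)%E.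
Proof.
move=> lam0; apply: le_trans (mass_hit_le1 hd hp (level x + n%:Z) x).
apply: le_esum_sub => [s /rise_hit//|s _].
rewrite lee_fin ler_piMr ?wt_ge0//.
apply: (@le_trans _ _ (1 `^ lam)); last by rewrite powR1.
by rewrite ge0_ler_powR ?nnegrE ?rise_mass_ge0 ?rise_mass_le1.
Qed.

Lemma moment_le n lam x : 0 <= lam -> (moment n lam x <= (#|T|%:R)%:E)%E.
Proof.
move=> lam0; apply: (@le_trans _ _ (\sum_(t : T) 1%E)%E).
  by apply: lee_sum => t _; exact: duel_le1.
by rewrite sumEFin sumr_const.
Qed.

Lemma moment_fin n lam x : 0 <= lam -> moment n lam x \is a fin_num.
Proof.
move=> lam0; rewrite ge0_fin_numE ?moment_ge0//.
by apply: le_lt_trans (moment_le _ _ lam0) _; rewrite ltry.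
Qed.

Section Translation.
Variables (c : int) (rho rho' : T -> T).
Hypotheses (rhoK : cancel rho rho') (rho'K : cancel rho' rho).
Let tau z : V := (z.1 + c, rho z.2).
Hypothesis trans_tau : forall z w, trans p (tau z) (tau w) = trans p z w.

Let tau' z : V := (z.1 - c, rho' z.2).
Let tauK : cancel tau tau'.
Proof. by move=> [i t]; rewrite /tau /tau' /= addrK rhoK. Qed.
Let tau'K : cancel tau' tau.
Proof. by move=> [i t]; rewrite /tau /tau' /= subrK rho'K. Qed.
Let level_tau z : level (tau z) = level z + c. Proof. by []. Qed.

Let wt_tau x s : wt (tau x) (map tau s) = wt x s.
Proof. by elim: s x => //= z s IH x; rewrite trans_tau IH. Qed.

Let hit_tau m x s : hit (m + c) (tau x) (map tau s) = hit m x s.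
Proof.
by elim: s x => [|z s IH] x /=; rewrite (inj_eq (addIr c)) ?IH.
Qed.

Let rise_tau n x s : rise n (tau x) (map tau s) = rise n x s.
Proof.
rewrite /rise level_tau addrAC hit_tau all_map; congr andb.
by apply: eq_all => v /=; rewrite ltrD2r.
Qed.

Let ind_tau K s : ind (tau @` K) (map tau s) = ind K s.
Proof.
rewrite /ind; congr (nat_of_bool _)%:R; apply/asboolP/asboolP => H v vs.
  by move=> Kv; apply: (H (tau v)); [exact: map_f|exists v].
move: vs => /mapP[w ws ->] [w' Kw' /(can_inj tauK) ww'].
by apply: (H w) => //; rewrite -ww'.
Qed.

Let bij_map n x :
  set_bij [set s | rise n x s] [set s | rise n (tau x) s] (map tau).
Proof.
split=> [s /=|s s' _ _|s /= rs]; first by rewrite rise_tau.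
  by apply: inj_map; exact: can_inj tauK.
have sE : s = map tau (map tau' s) by rewrite mapK.
by exists (map tau' s) => //=; rewrite -(rise_tau n x) -sE.
Qed.

Let rise_mass_tau n y K : rise_mass n (tau y) (tau @` K) = rise_mass n y K.
Proof.
apply: EFin_inj; apply: etrans (rise_massE _ _ _) _.
apply: etrans _ (esym (rise_massE _ _ _)).
rewrite (reindex_esum _ _ _ _ (bij_map n y)); apply: eq_esum => s _.
by rewrite wt_tau -map_cons ind_tau.
Qed.

Let duel_tau n lam x y : duel n lam (tau x) (tau y) = duel n lam x y.
Proof.
rewrite /duel (reindex_esum _ _ _ _ (bij_map n x)); apply: eq_esum => s _.
rewrite wt_tau (_ : [set` _] = tau @` [set` x :: s]) ?rise_mass_tau//.
apply/seteqP; split=> v /=; rewrite -(map_cons tau).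
  by move=> /mapP[w ws ->]; exists w.
by move=> [w ws <-]; exact: map_f.
Qed.

Lemma moment_translate n lam x :
  moment n lam (x.1 + c, rho x.2) = moment n lam x.
Proof.
transitivity (\sum_(t : T) duel n lam (tau x) (tau (level x, t)))%E.
  exact: (reindex_inj (can_inj rhoK)).
by apply: eq_bigr => t _; exact: duel_tau.
Qed.

End Translation.

Lemma trans_morph (f : V -> V) : injective f ->
    (forall z, f (step_up z) = step_up (f z)) ->
    (forall z, f (step_down z) = step_down (f z)) ->
    (forall i z, f (step_plus i z) = step_plus i (f z)) ->
    (forall i z, f (step_minus i z) = step_minus i (f z)) ->
  forall z w, trans p (f z) (f w) = trans p z w.
Proof.
move=> fI fu fd fp fm z w; rewrite /trans -fu -fd !(inj_eq fI).
by congr (_ + _); apply: eq_bigr => i _; rewrite -fp -fm !(inj_eq fI).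
Qed.

(** Vertical translations and rotations of the torus are symmetries of the walk
    that act transitively on the sites. *)
Lemma moment_const n lam x y : moment n lam x = moment n lam y.
Proof.
have H0 i j (t : T) : moment n lam (i, t) = moment n lam (j, t).
  have -> : (i, t) = ((j, t).1 + (i - j), id (j, t).2) by rewrite /= subrKC.
  apply: (@moment_translate (i - j) id id) => // z w.
  apply: (@trans_morph (fun z : V => (z.1 + (i - j), id z.2))) => //.
  - by move=> [a b] [a' b'] [/addIr -> ->].
  - by move=> v; rewrite /step_up /= addrAC.
  - by move=> v; rewrite /step_down /= addrAC.
case: x y => [i t] [j u]; rewrite (H0 i j).
pose P (v : T) := moment n lam (j, v) = moment n lam (j, u).
apply: (@torus_ind d L P u t); last by [].
move=> k v; rewrite /P => <-.
have -> : (j, turn k v) = ((j, v).1 + 0, turn k (j, v).2) by rewrite addr0.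
apply: (moment_translate (@turnK _ _ k) (@turn_backK _ _ k)) => z w.
apply: (@trans_morph (fun z : V => (z.1 + 0, turn k z.2))) => //.
- by move=> [a b] [a' b'] [/addIr -> /(can_inj (@turnK _ _ k)) ->].
- by move=> w'; rewrite /step_up /= !addr0.
- by move=> w'; rewrite /step_down /= !addr0.
- by move=> e w'; congr pair; exact: turnC.
- by move=> e w'; congr pair; exact: turn_turn_back.
Qed.

(** The walk may wander below its starting level before it climbs, but the
    part after the last visit to that level has to avoid [K] as well. *)
Lemma mass_hit_le_rise n y K :
  mass (hit (level y + n%:Z) y) y K <=
  green * \sum_(t : T) rise_mass n (level y, t) K.
Proof.
rewrite -lee_fin (massE hd hp K (fun s => id)) EFinM -sumEFin.
under eq_bigr do rewrite rise_massE.
apply: (last_exit_le hd hp (f := fun s => ind K (y :: s))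
  (g := fun v s => ind K (v :: s)) (fun v s => ind_ge0 R K (v :: s))).
move=> s1 s2 _ _ /=.
apply: ind_sub => v; rewrite inE => /orP[/eqP ->|vs] Kv; split => //.
  by rewrite -cat_cons mem_cat mem_last.
by rewrite -cat_cons mem_cat vs orbT.
Qed.

(** Comparing the sum with its largest term alone makes the bound valid for
    exponents below 1 as well as above. *)
Lemma sum_powR_le lam (f : T -> R) (t0 : T) :
  0 <= lam -> (forall t, 0 <= f t) ->
  (\sum_t f t) `^ lam <= #|T|%:R `^ lam * \sum_t f t `^ lam.
Proof.
move=> lam0 f0; pose t1 := [arg max_(t > t0) f t]%O.
have Ht1 t : f t <= f t1.
  by rewrite /t1; case: Order.TotalTheory.arg_maxP => // t2 _; apply.
apply: (@le_trans _ _ ((#|T|%:R * f t1) `^ lam)).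
  rewrite ge0_ler_powR ?nnegrE ?sumr_ge0 ?mulr_ge0//.
  by rewrite mulr_natl -sumr_const; apply: ler_sum.
rewrite powRM// ler_wpM2l ?powR_ge0// (bigD1 t1)//= lerDl.
by apply: sumr_ge0 => t _; exact: powR_ge0.
Qed.

Definition escape_cst lam : R :=
  green * ((#|T|%:R * green * #|T|%:R) `^ lam * #|T|%:R).

(** The key upper bound: after discarding everything that the two walks did
    before their last visits to the starting level, what is left is a duel, and
    the discarded parts cost only Green functions. *)
Lemma hit_moment_le n lam x : 0 <= lam ->
  (\esum_(s in [set s | hit (level x + n%:Z) x s])
    (wt x s * (\sum_(t : T) mass (hit (level x + n%:Z) (level x, t))
       (level x, t) [set` x :: s]) `^ lam)%:E
   <= (escape_cst lam)%:E * moment n lam x)%E.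
Proof.
move=> lam0; pose D := (#|T|%:R * green * #|T|%:R) `^ lam.
have g0 : 0 <= green by rewrite ltW// green_gt0.
have D0 : 0 <= D by exact: powR_ge0.
pose g v s := D * \sum_(t : T) rise_mass n (level x, t) [set` v :: s] `^ lam.
apply: le_trans (last_exit_le hd hp (g := g) _ _) _.
- by move=> v s; rewrite mulr_ge0// sumr_ge0// => t _; exact: powR_ge0.
- move=> s1 s2 e1 rs2.
  apply: (@le_trans _ _ ((#|T|%:R * green * \sum_(t : T)
      rise_mass n (level x, t) [set` last x s1 :: s2]) `^ lam)).
    have rise0 : 0 <= \sum_(t : T) rise_mass n (level x, t)
        [set` last x s1 :: s2] by apply: sumr_ge0 => t _; exact: rise_mass_ge0.
    have hit0 : 0 <= \sum_(t : T) mass (hit (level x + n%:Z) (level x, t))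
        (level x, t) [set` x :: s1 ++ s2].
      by apply: sumr_ge0 => t _; exact: mass_ge0.
    have c0 : 0 <= #|T|%:R * green by exact: mulr_ge0.
    apply: ge0_ler_powR; rewrite ?nnegrE ?(mulr_ge0 c0 rise0) //.
    rewrite -mulrA mulr_natl -sumr_const; apply: ler_sum => t _.
    apply: le_trans (mass_hit_le_rise n (level x, t) _) _.
    rewrite ler_wpM2l//; apply: ler_sum => u _.
    apply: (mass_le_sub hd hp (@rise_hit n _)) => v /=.
    rewrite -cat_cons inE mem_cat => /orP[/eqP ->|->]; last by rewrite orbT.
    by rewrite mem_last.
  rewrite powRM//; last first.
    by apply: sumr_ge0 => t _; exact: rise_mass_ge0.
    exact: mulr_ge0.
  rewrite /g /D [in leRHS]powRM//; last exact: mulr_ge0.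
  rewrite -mulrA ler_wpM2l ?powR_ge0//.
  by apply: sum_powR_le x.2 lam0 _ => t; exact: rise_mass_ge0.
rewrite /escape_cst -/D (EFinM green) -muleA lee_wpmul2l ?lee_fin//.
rewrite (EFinM D) -muleA.
rewrite [X in (_ <= _ * (X * _))%E](_ : _ = \sum_(t : T) 1%E)%E.
  rewrite ge0_sume_distrl// ge0_sume_distrr; last first.
    by move=> t _; rewrite mul1e moment_ge0.
  apply: lee_sum => t _; rewrite mul1e (moment_const n lam x (level x, t)).
  rewrite /moment -esum_sum; last by move=> s u _ _; exact: term_ge0.
  rewrite -esumZl//; last by move=> s; apply: sume_ge0 => u _; exact: term_ge0.
  apply: le_esum => s _.
  by rewrite sumEFin -EFinM lee_fin /g mulrCA mulr_sumr.
by rewrite sumEFin sumr_const.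
Qed.

End Moments.

(** * Almost multiplicativity of the duels *)

Lemma neq_addn (k : int) (n : nat) : (0 < n)%N -> k != k + n%:Z.
Proof. lia. Qed.

Section Multiplicativity.
Variables (R : realType) (d L : nat) (p : R).
Hypotheses (hd : (1 <= d)%N) (hp : 1 / 2 < p < 1).
Local Notation T := (torus d L).
Local Notation V := (vertex d L).
Implicit Types (x y z v w : V) (s : seq V) (K : set V) (n m : nat)
  (lam : R).
Local Notation wt := (wt p).
Local Notation mass := (mass p).
Local Notation ind := (@ind R d L).
Local Notation green := (green d p).
Local Notation rise_mass := (rise_mass p).
Local Notation duel := (duel p).
Local Notation moment := (moment p).
Local Notation escape_cst := (@escape_cst R d L p).

Lemma escape_cst_ge0 lam : 0 <= escape_cst lam.
Proof.
apply: mulr_ge0; first exact: ltW (green_gt0 hd hp).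
by apply: mulr_ge0; rewrite ?powR_ge0.
Qed.

Lemma mass_hit_le_sum (m : int) v K :
  mass (hit m v) v K <= \sum_(t : T) mass (hit m (level v, t)) (level v, t) K.
Proof.
have {1 2}-> : v = (level v, v.2) by rewrite /level -surjective_pairing.
rewrite (bigD1 v.2)//= lerDl; apply: sumr_ge0 => t _; exact: mass_ge0.
Qed.

(** Both trajectories are cut where they first reach height [n]: the first
    parts form a duel, and [hit_moment_le] bounds the rest, which may still come
    back below that height. *)
Lemma duel_add_le n m lam x y : 0 <= lam -> level y = level x ->
  (duel (n + m) lam x y
     <= duel n lam x y * ((escape_cst lam)%:E * moment m lam x))%E.
Proof.
move=> lam0 yx; set l := level x + n%:Z.
have lE : level x + (n + m)%N%:Z = l + m%:Z by rewrite PoszD addrA.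
pose A s1 s2 := \sum_(t : T)
  mass (hit (l + m%:Z) (l, t)) (l, t) [set` last x s1 :: s2].
have A0 s1 s2 : 0 <= A s1 s2 by apply: sumr_ge0 => t _; exact: mass_ge0.
apply: le_trans (esum_le_cover (I := [set s1 | rise n x s1])
  (J := fun s1 => [set s2 | hit (l + m%:Z) (last x s1) s2]) (h := cat)
  (g := fun s1 s2 => ((wt x s1 * rise_mass n y [set` x :: s1] `^ lam)%:E *
     (wt (last x s1) s2 * A s1 s2 `^ lam)%:E)%E) _ _) _.
- by move=> s1 s2 _ _; rewrite mule_ge0 ?lee_fin ?mulr_ge0 ?wt_ge0 ?powR_ge0.
- move=> s /= rs; rewrite eqe mulf_eq0 negb_or => /andP[s0 _].
  have hs := rise_hit rs; rewrite lE in hs.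
  have [||s1 [s2 [e h1]]] := first_hit (m := l) s0.
  + by rewrite lerDl.
  + by rewrite (hit_last hs) lerDl.
  rewrite e in rs hs *; exists s1, s2; split => //.
  + by move: rs; rewrite /rise h1 all_cat => /and3P[_ ->].
  + exact: hit_cat hs.
  rewrite -EFinM lee_fin wt_cat [leRHS]mulrACA ler_wpM2l ?mulr_ge0 ?wt_ge0//.
  rewrite -powRM ?rise_mass_ge0//.
  rewrite ge0_ler_powR ?nnegrE ?mulr_ge0 ?rise_mass_ge0//.
  apply: (mass_split_le hd hp (m := l + m%:Z) (m1 := l)
    (K2 := [set` last x s1 :: s2])).
  + by move=> t /rise_hit; rewrite yx lE.
  + by move=> t /rise_hit; rewrite yx.
  + move=> t1 t2; rewrite /rise yx => /andP[_].
    by rewrite all_cat => /andP[-> _] h; rewrite andbT.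
  + by rewrite yx !lerDl.
  + move=> t1 _ _; apply: ind_sub => v vt /= vs; split => //.
    by move: vs; rewrite -cat_cons mem_cat => ->.
  + move=> v /=; rewrite -cat_cons inE mem_cat => /orP[/eqP ->|->].
      by rewrite mem_last.
    by rewrite orbT.
  + exact: A0.
  + move=> t1 /rise_hit /hit_last e1 _ _.
    by apply: le_trans (mass_hit_le_sum _ _ _) _; rewrite e1 yx.
have Mfin := moment_fin hd hp m x lam0.
apply: le_trans (_ : \esum_(s1 in [set s1 | rise n x s1])
   (((escape_cst lam)%:E * moment m lam x) *
   (wt x s1 * rise_mass n y [set` x :: s1] `^ lam)%:E) <= _)%E.
  apply: le_esum => s1 /= /rise_hit /hit_last e1.
  rewrite esumZl ?mulr_ge0 ?wt_ge0 ?powR_ge0//; last first.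
    by move=> s2; rewrite lee_fin mulr_ge0 ?wt_ge0 ?powR_ge0.
  rewrite muleC lee_wpmul2r ?lee_fin ?mulr_ge0 ?wt_ge0 ?powR_ge0//.
  rewrite (moment_const hd hp m lam x (last x s1)).
  apply: le_trans (hit_moment_le hd hp m (last x s1) lam0).
  by rewrite e1.
have C0 := escape_cst_ge0 lam.
rewrite -(fineK Mfin) -EFinM esumZl; first by rewrite muleC.
  by rewrite mulr_ge0// fine_ge0// moment_ge0.
by move=> s; rewrite lee_fin mulr_ge0 ?wt_ge0 ?powR_ge0.
Qed.

Lemma moment_add_le n m lam x : 0 <= lam ->
  (moment (n + m) lam x
     <= (escape_cst lam)%:E * (moment n lam x * moment m lam x))%E.
Proof.
move=> lam0; rewrite muleCA.
have H t := @duel_add_le n m lam x (level x, t) lam0 erefl.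
move: (_ * moment m lam x)%E H => M H; rewrite !momentE.
rewrite ge0_sume_distrl; last by move=> t _; exact: duel_ge0.
exact: lee_sum.
Qed.

(** Moving sideways from [y] to [y'] around the site [x] of their level costs a
    factor that depends on none of them: the weight of a horizontal step does
    not depend on the level, which has finitely many sites. *)
Lemma sidestep : exists2 c : R, 0 < c <= 1 & forall x y y',
  level y = level x -> level y' = level x -> y != x -> y' != x ->
  exists h : seq V, [/\ last y h = y', all (fun v => level v == level x) h,
    x \notin y :: h & c <= wt y h].
Proof.
have d0 : 0 < d%:R :> R by rewrite ltr0n.
pose e : R := (2 * d%:R)^-1.
have e0 : 0 < e by rewrite invr_gt0 mulr_gt0.
have e1 : e <= 1.
  by rewrite invf_le1 ?mulr_gt0// -natrM ler1n muln_gt0.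
pose P (o t u : T) (r : nat) := t != o -> u != o -> forall k : int,
  exists h : seq V, [/\ last ((k, t) : V) h = (k, u),
    all (fun v => level v == k) h, (k, o) \notin ((k, t) : V) :: h
    & e ^+ r <= wt (k, t) h].
have ex (o t u : T) : exists r, P o t u r.
  have [->|to] := eqVneq t o; first by exists 0%N; rewrite /P eqxx.
  have [->|uo] := eqVneq u o; first by exists 0%N; rewrite /P eqxx.
  have step (v w : T) (i : 'I_d.-1) : w != o ->
      (forall k : int, ((k, w) == step_plus i ((k, v) : V)) ||
         ((k, w) == step_minus i ((k, v) : V))) ->
      (exists r, P o t v r) -> v != o -> exists r, P o t w r.
    move=> wo vw [r Pr] vo; exists r.+1 => _ _ k.
    have [h [hv hk ho hr]] := Pr to vo k; exists (rcons h (k, w)).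
    rewrite last_rcons all_rcons -rcons_cons mem_rcons inE negb_or ho hk /=.
    split=> //; first by rewrite eqxx.
      by rewrite andbT; apply: contraNneq wo => -[->].
    rewrite -cats1 wt_cat hv /= mulr1 exprSr ler_pM ?exprn_ge0 ?(ltW e0)//.
    by apply: (trans_step_side hp) (vw k).
  apply: (@torus_minus_point_ind d L o
    (fun u => exists r, P o t u r) t u) => //.
  - by move=> i v vo wo Pv; apply: (step v _ i) => // k; rewrite eqxx.
  - by move=> i v vo wo Pv; apply: (step v _ i) => // k; rewrite eqxx orbT.
  - by exists 0%N => _ _ k; exists [::]; rewrite inE xpair_eqE eqxx /= eq_sym.
have /choice[r Pr] : forall q : T * T * T, exists r, P q.1.1 q.1.2 q.2 r.
  by move=> [[t0 t] u]; exact: ex.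
exists (e ^+ \max_q r q)%N.
  by rewrite exprn_gt0// exprn_ile1// ltW.
move=> [k t0] [k1 t] [k2 u] /= e2 e3; move: e2 e3; rewrite /level /= => -> ->.
rewrite !xpair_eqE !eqxx /= => to uo.
have [h [h1 h2 h3 h4]] := Pr (t0, t, u) to uo k; exists h; split=> //.
apply: le_trans h4; apply: ler_wiXn2l => //; first exact: ltW.
exact: leq_bigmax.
Qed.

(** Unlike [rise], this leaves room for steps along the starting level. *)
Definition climb n x s :=
  hit (level x + n%:Z) x s && all (fun v => level x <= level v) s.

Lemma climb_hit n x s : climb n x s -> hit (level x + n%:Z) x s.
Proof. by case/andP. Qed.

Section Gluing.
Variable c : R.
Hypothesis c01 : 0 < c <= 1.
Hypothesis detour : forall x y y',
  level y = level x -> level y' = level x -> y != x -> y' != x ->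
  exists h : seq V, [/\ last y h = y', all (fun v => level v == level x) h,
    x \notin y :: h & c <= wt y h].

Let c0 : 0 < c. Proof. by case/andP: c01. Qed.
Let c1 : c <= 1. Proof. by case/andP: c01. Qed.

(** Against a walk that never comes back to its starting level, the opponent
    does as well from any site of that level, up to the factor [c]: it first
    walks sideways to the best site. *)
Lemma climb_mass_ge n x y y' s : level y = level x -> level y' = level x ->
    y != x -> all (fun v => level x < level v) s ->
  c * rise_mass n y' [set` x :: s] <= mass (climb n y) y [set` x :: s].
Proof.
move=> yx y'x nyx xs.
have xsP v : v \in x :: s -> level v = level x -> v = x.
  by rewrite inE => /orP[/eqP//|/(allP xs)]; lia.
have [->|n0] := posnP n.
  apply: (@le_trans _ _ 1).
    by rewrite -[leRHS]mulr1 ler_pM ?rise_mass_ge0 ?rise_mass_le1// ltW.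
  have Sn : climb 0 y [::] by rewrite /climb /= addr0 eqxx.
  apply: le_trans (mass_ge_term hd hp _ (@climb_hit 0 y) Sn).
  rewrite /= mul1r ind_eq1// => v; rewrite inE => /eqP -> /= yK.
  by move: nyx; rewrite (xsP y yK yx) eqxx.
have [->|ny'x] := eqVneq y' x.
  have -> : rise_mass n x [set` x :: s] = 0.
    apply: EFin_inj; rewrite rise_massE//; apply: esum1 => t _.
    have -> : ind [set` x :: s] (x :: t) = 0; last by rewrite mulr0.
    apply/eqP; apply/negPn/negP => /ind_neq0 /(_ x (mem_head _ _)); apply.
    by rewrite /= mem_head.
  by rewrite mulr0 mass_ge0.
have [h [hy' hx xh ch]] := detour yx y'x nyx ny'x.
have := massE hd hp [set` x :: s] (@climb_hit n y).
have := rise_massE hd hp n y' [set` x :: s].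
move: (rise_mass _ _ _) (mass _ _ _) => A B EA EB.
rewrite -lee_fin EFinM EA EB {A B EA EB}.
rewrite -esumZl ?(ltW c0)//; last first.
  by move=> t; rewrite lee_fin mulr_ge0 ?wt_ge0 ?ind_ge0.
pose F t := (wt y t * ind [set` x :: s] (y :: t))%:E.
apply: (@le_trans _ _ (\esum_(t in [set t | rise n y' t]) F (h ++ t))).
  apply: le_esum => t /andP[_ y't]; rewrite -EFinM lee_fin wt_cat hy' mulrA.
  rewrite ler_pM ?mulr_ge0 ?wt_ge0 ?ind_ge0 ?(ltW c0)//.
    by rewrite ler_wpM2r ?wt_ge0.
  apply: ind_sub => v; rewrite -cat_cons mem_cat.
  move=> /orP[vh vK|vt vK]; last first.
    by rewrite inE vt orbT.
  have lv : level v = level x.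
    move: vh; rewrite inE => /orP[/eqP ->//|/(allP hx)/eqP //].
  by move: xh; rewrite -(xsP v vK lv) vh.
rewrite -(esum_image _ (cat h) F); last first.
  by move=> t t' _ _ /eqP; rewrite eqseq_cat// eqxx => /eqP.
apply: le_esum_subset => _ [t /= rt <-]; have := rise_hit rt.
move/andP: rt => [_ y't] ht; rewrite /climb hit_cat_avoid.
  rewrite hy' yx -y'x ht all_cat /=; apply/andP; split; apply/allP => v.
    by move=> /(allP hx)/eqP ->; rewrite y'x.
  by move=> /(allP y't)/ltW.
rewrite /= yx neq_addn//=.
by apply/allP => v /(allP hx)/eqP ->; exact: neq_addn.
Qed.

(** After a duel of height [n] the walks stand at different sites of a level
    that neither of them will cross downwards; the second walk steps aside to
    [y'], and a new duel of height [m] starts there.  The two halves cannot meet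
    each other, since this level separates them; this needs [n > 0], for
    otherwise the sidestep would come back to the starting level. *)
Lemma rise_mass_add_ge n m x y y' s1 s2 : (0 < n)%N -> level y = level x ->
    rise n x s1 -> wt x s1 != 0 -> level y' = level x + n%:Z ->
    rise m (last x s1) s2 ->
  rise_mass n y [set` x :: s1] * (c * rise_mass m y' [set` last x s1 :: s2])
    <= rise_mass (n + m) y [set` x :: s1 ++ s2].
Proof.
move=> n0 yx r1 w1 y'l r2; set l := level x + n%:Z.
have xl : level x <= l by rewrite lerDl.
have e1 : level (last x s1) = l := hit_last (rise_hit r1).
have lE : level x + (n + m)%N%:Z = l + m%:Z by rewrite PoszD addrA.
have lo v : v \in x :: s1 -> level v < l \/ v = last x s1.
  rewrite lastI mem_rcons inE => /orP[/eqP|]; first by right.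
  by move=> vb; left; apply: (allP (hit_belast_lt w1 xl (rise_hit r1))).
have hi v : v \in s2 -> l < level v.
  by move/andP: r2 => [_ /allP H] /H; rewrite e1.
have Khi v : l <= level v -> v \in x :: s1 ++ s2 -> v \in last x s1 :: s2.
  move=> lv; rewrite -cat_cons mem_cat => /orP[/lo[|->]|vs].
  - by rewrite ltNge lv.
  - exact: mem_head.
  - by rewrite inE vs orbT.
apply: (mass_split_ge hd hp (m := l + m%:Z) (m1 := l)
  (S2 := fun v => [pred t | (level v == l) && climb m v t])).
- by move=> t /rise_hit; rewrite yx lE.
- by move=> t /rise_hit; rewrite yx.
- by move=> v t /andP[/eqP <- /climb_hit].
- move=> t1 t2 rt1 wt1 /andP[_ /andP[ht2 ct2]]; have ht1 := rise_hit rt1.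
  have et1 := hit_last ht1; rewrite yx -/l in et1; rewrite et1 in ht2 ct2.
  rewrite /rise yx lE all_cat; apply/and3P; split.
  + rewrite yx -/l in ht1.
    by apply: hit_catI wt1 _ _ ht1 ht2; rewrite ?yx ?lerDl.
  + by case/andP: rt1; rewrite yx.
  + by apply/allP => v /(allP ct2); apply: lt_le_trans; rewrite ltrDl ltz_nat.
- move=> t1 rt1 wt1; apply: ind_sub => v vt vK; split => //.
  have ht1 := rise_hit rt1; have et1 := hit_last ht1.
  move: vK; rewrite /= -cat_cons mem_cat => /orP[//|/hi]; rewrite ltNge.
  move: vt; rewrite lastI mem_rcons inE => /orP[/eqP ->|vb].
    by rewrite et1 yx lexx.
  rewrite ltW// /l -yx; apply: (allP (hit_belast_lt wt1 _ ht1) _ vb).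
  by rewrite lerDl.
- by rewrite mulr_ge0 ?(ltW c0) ?rise_mass_ge0.
- move=> t1 rt1 wt1 /ind_neq0 t1K; have et1 := hit_last (rise_hit rt1).
  have t1x : last y t1 != last x s1.
    apply: contra_notN (t1K _ (mem_last _ _)) => /eqP -> /=.
    by rewrite mem_last.
  have H : c * rise_mass m y' [set` last x s1 :: s2] <=
      mass (climb m (last y t1)) (last y t1) [set` last x s1 :: s2].
    apply: climb_mass_ge => //; first by rewrite et1 e1 yx.
      by rewrite y'l e1.
    by case/andP: r2.
  apply: le_trans H _; apply: (mass_le hd hp (m := l + m%:Z)).
  + by move=> t /andP[/eqP <- /climb_hit].
  + by move=> t ct; rewrite inE /= ct et1 yx eqxx.
  + move=> t /andP[_ /allP ct]; apply: ind_sub => v vt vK; split => //.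
    apply: Khi => //; move: vt; rewrite inE => /orP[/eqP ->|/ct].
      by rewrite et1 yx.
    by rewrite et1 yx.
Qed.

(** The starting site of the second duel is free, so that one may average over
    the level. *)
Lemma duel_add_ge n m lam x y : (0 < n)%N -> 0 <= lam -> level y = level x ->
  (duel n lam x y * ((c `^ lam)%:E * moment m lam x)
     <= (#|T|%:R)%:E * duel (n + m) lam x y)%E.
Proof.
move=> n0 lam0 yx; set l := level x + n%:Z.
have Mfin := moment_fin hd hp m x lam0.
pose f s := (wt x s * rise_mass (n + m) y [set` x :: s] `^ lam)%:E.
have f0 s : (0 <= f s)%E by rewrite lee_fin mulr_ge0 ?wt_ge0 ?powR_ge0.
pose a s := (wt x s * rise_mass n y [set` x :: s] `^ lam).
have a0 s : 0 <= a s by rewrite mulr_ge0 ?wt_ge0 ?powR_ge0.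
pose b s1 s2 t :=
  wt (last x s1) s2 * rise_mass m (l, t) [set` last x s1 :: s2] `^ lam.
have b0 s1 s2 t : 0 <= b s1 s2 t by rewrite mulr_ge0 ?wt_ge0 ?powR_ge0.
have lE : level x + (n + m)%N%:Z = l + m%:Z by rewrite PoszD addrA.
have cl0 : 0 <= c `^ lam by exact: powR_ge0.
have -> : ((#|T|%:R)%:E * duel (n + m) lam x y =
    \esum_(s in [set s | rise (n + m) x s]) ((#|T|%:R)%:E * f s))%E.
  exact: esym (esumZl _ (ler0n _ _) f0).
apply: le_trans (esum_ge_inj (I := [set s1 | rise n x s1])
  (J := fun s1 => [set s2 | rise m (last x s1) s2]) (h := cat)
  (g := fun s1 s2 => ((a s1)%:E * (c `^ lam * \sum_t b s1 s2 t)%:E)%E) _ _ _).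
- have inner s1 : rise n x s1 ->
      (\esum_(s2 in [set s2 | rise m (last x s1) s2])
        ((a s1)%:E * (c `^ lam * \sum_t b s1 s2 t)%:E) =
      ((c `^ lam)%:E * moment m lam x) * (a s1)%:E)%E.
    move=> rs1; rewrite esumZl//; last first.
      by move=> s2; rewrite lee_fin mulr_ge0// sumr_ge0.
    rewrite muleC; congr (_ * _)%E.
    transitivity (\esum_(s2 in [set s2 | rise m (last x s1) s2])
        ((c `^ lam)%:E * (\sum_t b s1 s2 t)%:E))%E.
      by apply: eq_esum => s2 _; rewrite EFinM.
    rewrite esumZl//; last by move=> s2; rewrite lee_fin sumr_ge0.
    congr (_ * _)%E; rewrite (moment_const hd hp m lam x (last x s1)) momentE.
    transitivity (\esum_(s2 in [set s2 | rise m (last x s1) s2])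
        \sum_t (b s1 s2 t)%:E)%E.
      by apply: eq_esum => s2 _; rewrite sumEFin.
    rewrite esum_sum; last by move=> s2 t _ _; rewrite lee_fin.
    by rewrite (hit_last (rise_hit rs1)).
  rewrite (eq_esum inner) -(fineK Mfin) -EFinM esumZl; first by rewrite muleC.
    by rewrite mulr_ge0// fine_ge0// moment_ge0.
  by move=> s1; rewrite lee_fin.
- move=> s1 s2 _ _; rewrite mule_ge0 ?lee_fin//.
  by apply: mulr_ge0 => //; apply: sumr_ge0.
- move=> s1 s2 /= r1 r2; rewrite mule_eq0 negb_or eqe mulf_eq0 negb_or.
  move=> /andP[/andP[w1 _] _]; have e1 := hit_last (rise_hit r1).
  split.
    case/andP: r1 => h1 a1; case/andP: r2 => h2 a2; rewrite /rise all_cat a1 /=.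
    rewrite e1 -/l -lE in h2; apply/andP; split.
      by apply: hit_catI w1 _ _ h1 h2; rewrite ?lerDl// lerD2l lez_nat leq_addr.
    apply/allP => v /(allP a2); apply: lt_trans; rewrite e1.
    by rewrite ltrDl ltz_nat.
  rewrite -!EFinM lee_fin mulrA mulr_sumr mulr_natl -sumr_const.
  apply: ler_sum => t _; rewrite /a /b wt_cat.
  have key := rise_mass_add_ge n0 yx r1 w1 (erefl : level (l, t) = l) r2.
  move: key (rise_mass_ge0 hp n y [set` x :: s1]).
  move: (rise_mass_ge0 hp m (l, t) [set` last x s1 :: s2]).
  move: (rise_mass_ge0 hp (n + m) y [set` x :: s1 ++ s2]).
  move: (wt_ge0 hp x s1) (wt_ge0 hp (last x s1) s2).
  move: (rise_mass n y _) (rise_mass m _ _) (rise_mass (n + m) _ _) (wt x s1).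
  move: (wt (last x s1) s2) => v A B D u u0 v0 D0 B0 ABD A0.
  have cB0 : 0 <= c * B by rewrite mulr_ge0 ?(ltW c0).
  apply: (@le_trans _ _ (u * v * (A * (c * B)) `^ lam)).
    rewrite powRM// powRM ?(ltW c0)//.
    by rewrite le_eqVlt; apply/orP; left; apply/eqP; ring.
  by rewrite ler_wpM2l ?mulr_ge0// ge0_ler_powR ?nnegrE ?(mulr_ge0 A0 cB0).
- move=> s1 s2 s1' s2' /= /rise_hit h1 _ /rise_hit h1' _.
  exact: (hit_prefix_inj h1 h1').
Qed.

Lemma moment_add_ge n m lam x : (0 < n)%N -> 0 <= lam ->
  ((c `^ lam)%:E * (moment n lam x * moment m lam x)
     <= (#|T|%:R)%:E * moment (n + m) lam x)%E.
Proof.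
move=> n0 lam0; rewrite muleCA.
have H t := @duel_add_ge n m lam x (level x, t) n0 lam0 erefl.
move: (_ * moment m lam x)%E H => M H.
rewrite !momentE ge0_sume_distrl; last by move=> t _; exact: duel_ge0.
rewrite ge0_sume_distrr; last by move=> t _; exact: duel_ge0.
exact: lee_sum.
Qed.

End Gluing.

(** Both walks may climb straight up, from different sites of a level. *)
Lemma moment_gt0 n lam x t : t != x.2 -> (0 < moment n lam x)%E.
Proof.
move=> tx; set y : V := (level x, t).
have avoid : ind [set` x :: upline n x] (y :: upline n y) = 1.
  apply: ind_eq1 => v vy /= vx.
  have vt : v.2 = t by move: vy; rewrite inE => /orP[/eqP ->|/mem_upline[]].
  move: tx; rewrite -vt.
  by move: vx; rewrite inE => /orP[/eqP ->|/mem_upline[->]]; rewrite eqxx.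
rewrite momentE (bigD1 t)//= -/y.
rewrite lte_paddr//; first by apply: sume_ge0 => u _; exact: duel_ge0.
pose f s := (wt x s * rise_mass n y [set` x :: s] `^ lam)%:E.
apply: lt_le_trans (_ : f (upline n x) <= _)%E; last first.
  rewrite -(@esum_set1 R _ (upline n x) f); last first.
    by rewrite lee_fin mulr_ge0 ?wt_ge0 ?powR_ge0.
  by apply: le_esum_subset => _ -> /=; exact: rise_upline.
rewrite lte_fin mulr_gt0 ?wt_upline_gt0// powR_gt0//.
have := mass_ge_term hd hp [set` x :: upline n x] (@rise_hit d L n y)
  (rise_upline n y).
by rewrite avoid mulr1; apply: lt_le_trans; exact: wt_upline_gt0.
Qed.

End Multiplicativity.

(** * Integration over a countable partition *)

Section CountablePartition.
Context {dp : measure_display} {Omega : measurableType dp} {R : realType}.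
Variable mu : {measure set Omega -> \bar R}.
Local Open Scope ereal_scope.

Section Partition.
Variables (T : countType) (I : set T) (E : T -> set Omega).
Hypotheses (mE : forall i, measurable (E i)) (tE : trivIset I E).

Let F (n : nat) : set Omega :=
  if pickle_inv n is Some i then (if i \in I then E i else set0) else set0.

Let mF n : measurable (F n).
Proof. by rewrite /F; case: pickle_inv => // i; case: ifP. Qed.

Let F_pickle i : I i -> F (pickle i) = E i.
Proof. by move=> Ii; rewrite /F pickleK_inv mem_set. Qed.

Let FE n w : F n w -> exists i, [/\ I i, n = pickle i & E i w].
Proof.
rewrite /F; have := @pickle_invK T n; case: pickle_inv => //= i <-.
by case: ifPn => // /set_mem Ii Ew; exists i.
Qed.

Let tF : trivIset setT F.
Proof.
move=> n n' _ _ [w [/FE[i [Ii -> Ei]] /FE[i' [Ii' -> Ei']]]].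
by congr pickle; apply: (tE Ii Ii'); exists w.
Qed.

Let bigcupF : \bigcup_n F n = \bigcup_(i in I) E i.
Proof.
apply/seteqP; split=> w.
  by move=> [n _ /FE[i [Ii _ Ei]]]; exists i.
by move=> [i Ii Ei]; exists (pickle i) => //; rewrite F_pickle.
Qed.

Lemma measurable_partition : measurable (\bigcup_(i in I) E i).
Proof. by rewrite -bigcupF; apply: bigcup_measurable => n _; exact: mF. Qed.

Variables (f : Omega -> \bar R) (c : T -> \bar R).
Hypotheses (c0 : forall i, 0 <= c i)
  (fc : forall i w, I i -> E i w -> f w = c i).

Lemma measurable_fun_partition : measurable_fun (\bigcup_(i in I) E i) f.
Proof.
rewrite -bigcupF; apply/measurable_fun_bigcup => // n.
have [->|/set0P[w /FE[i [Ii -> _]]]] := eqVneq (F n) set0.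
  exact: measurable_fun_set0.
rewrite F_pickle//; apply: (eq_measurable_fun (cst (c i))) => //.
by move=> v /set_mem Ev; rewrite (fc Ii Ev).
Qed.

Lemma integral_partition :
  \int[mu]_(w in \bigcup_(i in I) E i) f w = \esum_(i in I) (c i * mu (E i)).
Proof.
rewrite -bigcupF ge0_integral_bigcup//; last 2 first.
- by rewrite bigcupF; exact: measurable_fun_partition.
- by move=> w [n _ /FE[i [Ii _ Ei]]]; rewrite (fc Ii Ei).
have f0 n w : F n w -> 0 <= f w by move=> /FE[i [Ii _ Ei]]; rewrite (fc Ii Ei).
rewrite nneseries_esumT; last by move=> n; apply: integral_ge0 => w; exact: f0.
pose b n := \int[mu]_(w in F n) f w.
transitivity (\esum_(n in pickle @` I) b n).
  rewrite [RHS]esum_mkcond; apply: eq_esum => n _; case: ifPn => // nI.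
  rewrite (_ : F n = set0) ?integral_set0//.
  rewrite -subset0 => w /FE[i [Ii nE _]]; move: nI; rewrite notin_setE; apply.
  by exists i.
rewrite esum_image; last by move=> i i' _ _; exact: (pcan_inj pickleK_inv).
apply: eq_esum => i Ii; rewrite /b F_pickle//.
rewrite (eq_integral (cst (c i))); last first.
  by move=> w /set_mem Ew; rewrite (fc Ii Ew).
exact: integral_cst.
Qed.

End Partition.

Import HBNNSimple.

Lemma ge0_le_integral_any (f g : Omega -> \bar R) :
    (forall w, 0 <= f w) -> (forall w, f w <= g w) ->
  \int[mu]_w f w <= \int[mu]_w g w.
Proof.
move=> f0 fg; have g0 w : 0 <= g w by exact: le_trans (f0 w) (fg w).
rewrite !ge0_integralTE//; apply: ereal_sup_le => _ [h hf <-].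
by exists h => // w; exact: le_trans (hf w) (fg w).
Qed.

(** The functionals of the stopped walk are controlled only where the walk
    stops.  Elsewhere [f] is replaced by 0 from below and by [+oo] from above;
    the integral, as a supremum over simple functions, is monotone. *)
Lemma ge0_integral_full (D : set Omega) (f : Omega -> \bar R) :
    measurable D -> mu (~` D) = 0 -> measurable_fun D f ->
    (forall w, 0 <= f w) ->
  \int[mu]_w f w = \int[mu]_(w in D) f w.
Proof.
move=> mD D0 mf f0; apply/eqP; rewrite eq_le; apply/andP; split; last first.
  rewrite integral_mkcond; apply: ge0_le_integral_any => w.
    exact: erestrict_ge0.
  by rewrite /patch; case: ifP.
pose g w := if w \in D then f w else +oo.
have g0 w : 0 <= g w by rewrite /g; case: ifP.
apply: (@le_trans _ _ (\int[mu]_w g w)).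
  apply: ge0_le_integral_any => // w; rewrite /g; case: ifP => // _.
  by rewrite leey.
have mg : measurable_fun setT g.
  rewrite -(setvU D); apply/measurable_funU => //; first exact: measurableC.
  split.
    apply: (eq_measurable_fun (cst +oo)) => // w; rewrite inE => Dw.
    by rewrite /g memNset.
  by apply: (eq_measurable_fun f) => // w wD; rewrite /g wD.
rewrite (@ge0_negligible_integral _ _ _ mu setT (~` D))//; last first.
  exact: measurableC.
rewrite setTD setCK le_eqVlt; apply/orP; left; apply/eqP.
by apply: eq_integral => w wD; rewrite /g wD.
Qed.

End CountablePartition.

(** * The stopped walk *)

Section Walk.
Variables (R : realType) (d L : nat) (p : R).
Hypotheses (hd : (1 <= d)%N) (hp : 1 / 2 < p < 1).
Local Notation T := (torus d L).
Local Notation V := (vertex d L).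
Implicit Types (x y z v w : V) (s : seq V) (K : set V).
Local Notation wt := (wt p).
Variable W : random_walk d L p.
Local Notation Omega := (walk_space W).
Local Notation pos := (@walk_pos R d L p W).
Implicit Types (omega : Omega).

Definition follows x s : set Omega :=
  [set omega | pos 0 omega = x /\
     forall t, (t < size s)%N -> pos t.+1 omega = nth x s t].

Lemma followsE x s : follows x s =
  [set omega | forall t, (t <= size s)%N -> pos t omega = nth x (x :: s) t].
Proof.
apply/seteqP; split=> omega /= => [[e0 es] [|t]|H] //=; first exact: es.
by split=> [|t ts]; [exact: (H 0%N)|exact: (H t.+1)].
Qed.

Lemma measurable_follows x s : measurable (follows x s).
Proof.
rewrite followsE (_ : mkset _ = \bigcap_(t in [set t | (t <= size s)%N])
    [set omega | pos t omega = nth x (x :: s) t]).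
  apply: bigcap_measurable; first by exists 0%N.
  by move=> t _; exact: walk_measurable.
by apply/seteqP; split.
Qed.

Lemma prob_follows x s : walk_prob W x (follows x s) = (wt x s)%:E.
Proof.
rewrite followsE (walk_law W x (size s) (nth x (x :: s))) eqxx mul1r.
congr (_%:E).
have H y u : \prod_(t < size u) trans p (nth x (y :: u) t)
    (nth x (y :: u) t.+1) = wt y u.
  by elim: u y => [|z u IH] y; rewrite ?big_ord0// big_ord_recl /= IH.
exact: H.
Qed.

Lemma follows_cat x s1 s2 : follows x (s1 ++ s2) `<=` follows x s1.
Proof.
move=> omega [e0 es]; split=> // t ts; rewrite es ?nth_cat ?ts//.
by rewrite size_cat ltn_addr.
Qed.

Lemma follows_prefix x s s' omega : (size s <= size s')%N ->
  follows x s omega -> follows x s' omega -> exists r, s' = s ++ r.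
Proof.
move=> ss [_ es] [_ es']; exists (drop (size s) s').
rewrite -{1}(cat_take_drop (size s) s'); congr cat.
apply: (@eq_from_nth _ x); rewrite size_takel// => t ts.
by rewrite nth_take// -es// -es'// (leq_trans ts).
Qed.

Lemma follows_hit_inj m x s s' omega : hit m x s -> hit m x s' ->
  follows x s omega -> follows x s' omega -> s = s'.
Proof.
wlog ss : s s' / (size s <= size s')%N.
  move=> H h h' f f'.
  case: (leqP (size s) (size s')) => [/H|/ltnW/H H']; first exact.
  by rewrite (H' h' h f' f).
move=> h h' f f'; have [r e] := follows_prefix ss f f'.
have := @hit_prefix_inj d L m x s r s' [::] h h'; rewrite cats0 -e => -[]//.
Qed.

Lemma follows_size_inj x s s' omega : size s = size s' ->
  follows x s omega -> follows x s' omega -> s = s'.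
Proof.
move=> ss f f'; have [r e] := @follows_prefix x s s' omega (eq_leq ss) f f'.
move: ss; rewrite e size_cat => /eqP.
rewrite -{1}[size s]addn0 eqn_add2l eq_sym size_eq0 => /eqP ->.
by rewrite cats0.
Qed.

Lemma stopped_range_follows m x s omega : hit m x s -> follows x s omega ->
  stopped_range m omega = [set` x :: s].
Proof.
rewrite followsE => hs es.
have hit_nth t : (t < size s)%N -> level (nth x (x :: s) t) != m.
  move=> ts; elim: s x hs {es} t ts => // z s IH x /= /andP[xm hs] [|t] ts //=.
  by rewrite (set_nth_default z) ?IH//= ltnS ltnW.
have hit_end : level (nth x (x :: s) (size s)) = m.
  by rewrite nth_last /= (hit_last hs).
apply/seteqP; split=> v /=.
  move=> [t <- Ht]; have ts : (t <= size s)%N.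
    by rewrite leqNgt; apply/negP => /Ht; rewrite es// hit_end eqxx.
  by rewrite es// mem_nth.
move=> /(nthP x)[t ts <-]; exists t; first by rewrite es.
move=> u ut; have us : (u < size s)%N by exact: leq_trans ut _.
by rewrite es ?hit_nth// ltnW.
Qed.

(** Trajectories of zero weight are left out because they may jump over levels,
    and hit level [m] before a lower one. *)
Definition hits m x : set (seq V) := [set s | hit m x s /\ wt x s != 0].

Lemma esum_hits m x (f : seq V -> R) :
  (\esum_(s in [set s | hit m x s]) (wt x s * f s)%:E =
   \esum_(s in hits m x) (wt x s * f s)%:E)%E.
Proof.
rewrite esum_neq0 [RHS]esum_neq0; congr (esum _ _).
apply/seteqP; split=> s [] => [/= h|[h w0]] e0; split=> //.
by split=> //; move: e0; rewrite eqe mulf_eq0 negb_or => /andP[].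
Qed.

Lemma trivIset_hits m x : trivIset (hits m x) (follows x).
Proof.
by move=> s s' [h _] [h' _] [w [f f']]; exact: (follows_hit_inj h h' f f').
Qed.

Lemma prob_bigcup_follows x (I : set (seq V)) : trivIset I (follows x) ->
  measurable (\bigcup_(s in I) follows x s) /\
  walk_prob W x (\bigcup_(s in I) follows x s) = \esum_(s in I) (wt x s)%:E.
Proof.
move=> tI; have mD := measurable_partition I (measurable_follows x).
split=> //; have := integral_partition (walk_prob W x) (measurable_follows x) tI
  (f := cst 1%E) (c := cst 1%E).
rewrite integral_cst// mul1e => -> //.
  by apply: eq_esum => s _; rewrite mul1e; exact: prob_follows.
Qed.

Lemma wt_prefix x s1 s2 : wt x (s1 ++ s2) != 0 -> wt x s1 != 0.
Proof. by rewrite wt_cat mulf_eq0 negb_or => /andP[]. Qed.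

Lemma hit_prefix m x s : ~~ all (fun v => level v != m) (x :: s) ->
  exists s1 s2, s = s1 ++ s2 /\ hit m x s1.
Proof.
elim: s x => [|z s IH] x.
  by rewrite /= andbT negbK => xm; exists [::], [::].
rewrite -cat1s all_cat negb_and [all _ [:: x]]/= andbT.
have [xm _|xm /= /IH[s1 [s2 [-> h]]]] := eqVneq (level x) m.
  by exists [::], (z :: s); rewrite /= xm eqxx.
by exists (z :: s1), s2; rewrite /= xm.
Qed.

(** The upward drift makes the hitting time of a higher level finite: the
    trajectories that have not hit it yet, taken of all lengths together, have a
    finite total weight, and those of each given length have at least the
    probability of never hitting. *)
Lemma prob_hits m x : level x <= m ->
  walk_prob W x (\bigcup_(s in hits m x) follows x s) = 1%E.
Proof.
move=> xm; set D := \bigcup_(s in _) _.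
have [mD _] := prob_bigcup_follows (@trivIset_hits m x).
rewrite -/D in mD.
pose A := [set s | all (fun v => level v != m) (x :: s)].
have [C HC] : exists C : R, (\esum_(s in A) (wt x s)%:E <= C%:E)%E.
  move: xm; rewrite le_eqVlt => /orP[/eqP xm|xm].
    exists 0; rewrite (_ : A = set0) ?esum_set0//.
    by rewrite -subset0 => s; rewrite /A /= xm eqxx.
  eexists; apply: le_trans (mass_never_hit hd hp xm).
  by apply: le_esum_subset => s /andP[].
pose e k := \esum_(s in A `&` [set s | size s = k]) (wt x s)%:E.
have e0 k : (0 <= e k)%E by apply: esum_ge0 => s _; rewrite lee_fin wt_ge0.
have step k : (1 <= walk_prob W x D + e k)%E.
  pose J := [set s | size s = k] `&` [set s | (wt x s)%:E != 0%E].
  have tsz (I : set (seq V)) : (forall s, I s -> size s = k) ->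
      trivIset I (follows x).
    move=> Ik s s' Is Is' [w [f f']].
    by apply: (follows_size_inj _ f f'); rewrite (Ik s Is) (Ik s' Is').
  have [_ P1] := prob_bigcup_follows (tsz [set s | size s = k] (fun s => id)).
  have full : \bigcup_(s in [set s | size s = k]) follows x s = follows x [::].
    apply/seteqP; split=> [w [s _ [e0' _]]|w [e0' _]]; first by split.
    exists (mkseq (fun t => pos t.+1 w) k); first by rewrite /= size_mkseq.
    by split=> // t; rewrite size_mkseq => tk; rewrite nth_mkseq.
  rewrite full prob_follows esum_neq0 -/J in P1.
  have [mJ PJ] := prob_bigcup_follows (tsz J (fun s => @proj1 _ _)).
  have [mI PI] := prob_bigcup_follows
    (tsz (A `&` [set s | size s = k]) (fun s => @proj2 _ _)).
  rewrite P1 -PJ /e -PI; apply: le_trans (measureU2 _ _ _) => //.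
  apply: le_measure; rewrite ?inE//; first exact: measurableU.
  move=> w [s [ss]]; rewrite /= eqe => s0 f.
  have [sA|/hit_prefix[s1 [s2 [es h1]]]] :=
    boolP (all (fun v => level v != m) (x :: s)).
    by right; exists s.
  left; exists s1; last by apply: (@follows_cat x s1 s2); rewrite -es.
  by split=> //; apply: (@wt_prefix x s1 s2); rewrite -es.
have sume (N : nat) : (\sum_(k < N) e k <= C%:E)%E.
  rewrite /e; under eq_bigr do rewrite esum_mkcondr.
  rewrite -esum_sum; last first.
    by move=> s k _ _; case: ifP; rewrite ?lee_fin ?wt_ge0.
  apply: le_trans HC; apply: le_esum => s _.
  rewrite -big_mkcond /= (eq_bigl (fun k : 'I_N => k == size s :> nat)).
    rewrite (big_ord1_eq _ (fun=> (wt x s)%:E)).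
    by case: ifP; rewrite ?lee_fin ?wt_ge0.
  by move=> k; apply/idP/eqP; rewrite inE /= => ->.
apply/eqP; rewrite eq_le probability_le1//= leNgt; apply/negP => PD.
have PDfin : walk_prob W x D \is a fin_num by exact: fin_num_measure.
pose a := 1 - fine (walk_prob W x D).
have a0 : 0 < a by rewrite subr_gt0 -lte_fin fineK.
have ea k : (a%:E <= e k)%E.
  by rewrite /a EFinB fineK// leeBlDl.
have bnd (N : nat) : N%:R * a <= C.
  rewrite -lee_fin; apply: le_trans (sume N).
  apply: (@le_trans _ _ (\sum_(k < N) a%:E)%E).
    by rewrite sumEFin sumr_const card_ord mulr_natl.
  by apply: lee_sum => k _.
have := bnd (Num.truncn (`|C| / a)).+1; apply/negP; rewrite -ltNge.
rewrite -ltr_pdivrMr//; apply: le_lt_trans (truncnS_gt _).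
by rewrite ler_wpM2r ?invr_ge0 ?(ltW a0)// ler_norm.
Qed.

(** As the walk almost surely stops, its stopped trajectory has a discrete
    law. *)
Lemma integral_stopped m x (f : Omega -> R) (phi : seq V -> R) :
    level x <= m -> (forall omega, 0 <= f omega) -> (forall s, 0 <= phi s) ->
    (forall s omega, hits m x s -> follows x s omega -> f omega = phi s) ->
  (\int[walk_prob W x]_omega (f omega)%:E =
   \esum_(s in [set s | hit m x s]) (wt x s * phi s)%:E)%E.
Proof.
move=> xm f0 phi0 fphi.
have [mD _] := prob_bigcup_follows (@trivIset_hits m x).
have fc s (w : Omega) : hits m x s -> follows x s w -> (f w)%:E = (phi s)%:E.
  by move=> hs fw; rewrite (fphi s w).
have c0 s : (0 <= (phi s)%:E)%E by rewrite lee_fin.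
rewrite (ge0_integral_full (D := \bigcup_(s in hits m x) follows x s))//.
- rewrite (integral_partition (walk_prob W x) (measurable_follows x)
    (@trivIset_hits m x) c0 fc) esum_hits.
  apply: eq_esum => s _; apply: etrans (_ : _ * (wt x s)%:E = _)%E.
    by congr (_ * _)%E; exact: prob_follows.
  by rewrite -EFinM mulrC.
- apply: etrans (probability_setC (walk_prob W x) mD) _.
  by rewrite prob_hits// subee.
- exact: (measurable_fun_partition (measurable_follows x) fc).
Qed.

Lemma measurable_avoids m K : measurable (avoids (W := W) m K).
Proof.
have mP (A : set V) t : measurable [set w : Omega | A (pos t w)].
  rewrite (_ : mkset _ = \bigcup_(v in A) [set w | pos t w = v]).
    rewrite bigcup_mkcond; apply: countable_bigcupT_measurable.
      exact: (countableP (T := (int * torus d L)%type)).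
    by move=> v; case: ifP => // _; exact: walk_measurable.
  by apply/seteqP; split=> [w Aw|w [v Av /= e]]; [exists (pos t w)|rewrite e].
rewrite (_ : avoids _ _ = \bigcap_t
   ((\bigcup_(s in [set s | (s < t)%N]) [set w | level (pos s w) = m])
     `|` [set w | (~` K) (pos t w)])).
  apply: bigcap_measurable; first by exists 0%N.
  move=> t _; apply: measurableU; last exact: (mP (~` K)).
  by apply: bigcup_measurable => s _; exact: (mP [set v | level v = m]).
apply/seteqP; split=> w.
  move=> /= wK t _.
  have [|H] := pselect (exists2 s, (s < t)%N & level (pos s w) = m).
    by move=> [s st sm]; left; exists s.
  right => /= Kt; have : (stopped_range m w `&` K) (pos t w).
    split=> //; exists t => // s st; apply/eqP => sm; apply: H; by exists s.
  by rewrite wK.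
move=> H; rewrite /avoids /= -subset0 => v [[t tv Ht] Kv].
have [[s st /= sm]|/=] := H t I; first by have := Ht s st; rewrite sm eqxx.
by rewrite tv.
Qed.

Lemma avoids_follows m x s omega K : hit m x s -> follows x s omega ->
  avoids m K omega <-> forall v, v \in x :: s -> ~ K v.
Proof.
move=> hs fs; rewrite /avoids /= (stopped_range_follows hs fs); split.
  by move=> H v vs Kv; have : set0 v by rewrite -H.
by move=> H; rewrite -subset0 => v [/H].
Qed.

(** Up to a null event, the walk started below level 0 hits level 0 before level
    [n]; avoiding [K] up to the later time then implies avoiding the smaller set
    [K0] up to the earlier one. *)
Lemma prob_avoids_both (n : nat) x K K0 : level x <= 0 -> K0 `<=` K ->
  walk_prob W x (avoids n%:Z K `&` avoids 0 K0)
    = (mass p (hit n%:Z x) x K)%:E.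
Proof.
move=> x0 K0K; have xn : level x <= n%:Z by exact: le_trans x0 _.
have mA : measurable (avoids (W := W) n%:Z K `&` avoids 0 K0).
  by apply: measurableI; exact: measurable_avoids.
rewrite -[X in _ X = _]setIT -integral_indic//.
rewrite (integral_stopped (phi := fun s => ind R K (x :: s)) xn)//.
  by rewrite -(massE hd hp K (fun s => id)).
move=> s w [hs s0] fw; rewrite /indic /ind; congr (nat_of_bool _)%:R.
apply/idP/asboolP; rewrite inE.
  by move=> [/(avoids_follows _ hs fw)].
move=> sK; split; first exact/(avoids_follows _ hs fw).
have [|s1 [s2 [e h1]]] := first_hit s0 x0; first by rewrite (hit_last hs).
have fw1 : follows x s1 w by apply: (@follows_cat x s1 s2); rewrite -e.
apply/(avoids_follows _ h1 fw1) => v vs1 /K0K; apply: sK.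
by rewrite e -cat_cons mem_cat vs1.
Qed.

Lemma prob_avoids x K : level x <= 0 ->
  walk_prob W x (avoids 0 K) = (mass p (hit 0 x) x K)%:E.
Proof.
by move=> x0; rewrite -(@prob_avoids_both 0 x K K)// setIid.
Qed.

Lemma cond_prob_avoids (n : nat) x K K0 : level x <= 0 -> K0 `<=` K ->
  cond_prob (walk_prob W x) (avoids n%:Z K) (avoids 0 K0) =
  mass p (hit n%:Z x) x K / mass p (hit 0 x) x K0.
Proof.
by move=> x0 K0K; rewrite /cond_prob prob_avoids_both// prob_avoids.
Qed.

End Walk.

(** * Nice paths and the upper bound on the exponent functional *)

Section Joined.
Variables (d L : nat).
Local Notation T := (torus d L).
Local Notation V := (vertex d L).
Implicit Types (z w v : V) (A : set V) (g : int -> Defs.fpath d L).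

Lemma step_upK : cancel (@step_up d L) (@step_down d L).
Proof. by move=> [k t]; rewrite /step_up /step_down /= addrK. Qed.

Lemma step_downK : cancel (@step_down d L) (@step_up d L).
Proof. by move=> [k t]; rewrite /step_up /step_down /= subrK. Qed.

Lemma step_plusK i : cancel (@step_plus d L i) (@step_minus d L i).
Proof. by move=> [k t]; congr pair; exact: turnK. Qed.

Lemma step_minusK i : cancel (@step_minus d L i) (@step_plus d L i).
Proof. by move=> [k t]; congr pair; exact: turn_backK. Qed.

Lemma adj_sym z w : adj z w -> adj w z.
Proof.
move=> /or3P[/eqP ->|/eqP ->|/existsP[i /orP[/eqP ->|/eqP ->]]]; apply/or3P.
- by apply: Or32; rewrite step_upK.
- by apply: Or31; rewrite step_downK.
- by apply: Or33; apply/existsP; exists i; rewrite step_plusK eqxx orbT.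
- by apply: Or33; apply/existsP; exists i; rewrite step_minusK eqxx.
Qed.

Lemma joined_sym A z w : joined A z w -> joined A w z.
Proof.
move=> [s [ps ls As]]; exists (rev (belast z s)).
have ms v : v \in w :: rev (belast z s) -> v \in z :: s.
  by rewrite (lastI z s) ls -rev_rcons mem_rev.
split; last by move=> v /ms /As.
  rewrite -ls rev_path; apply: sub_path ps => a b; exact: adj_sym.
by case: s ls {ps As ms} => [//|u s] ls; rewrite /= rev_cons last_rcons.
Qed.

Lemma joined_trans A z w v : joined A z w -> joined A w v -> joined A z v.
Proof.
move=> [s [ps ls As]] [s' [ps' ls' As']]; exists (s ++ s'); split.
- by rewrite cat_path ps ls.
- by rewrite last_cat ls.
move=> u; rewrite -cat_cons mem_cat => /orP[/As//|us']; apply: As'.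
by rewrite inE us' orbT.
Qed.

Lemma Dset_unbounded g z m : Dset g z -> exists2 w, Dset g w & level w <= m.
Proof.
move=> [[w0 [w00 zw0]] zinf]; have [w [wm zw]] := zinf m.
have wz := joined_sym zw; exists w; last exact: wm.
split; first by exists w0; split; [exact: w00|exact: joined_trans wz zw0].
move=> k; have [u [uk zu]] := zinf k.
by exists u; split; [exact: uk|exact: joined_trans wz zu].
Qed.

Lemma D_to_ninfty_proper g : Dset g !=set0 -> ProperFilter (D_to_ninfty g).
Proof.
move=> [z Dz]; apply: filter_from_proper; last first.
  by move=> m _; have [w Dw wm] := Dset_unbounded m Dz; exists w.
apply: filter_from_filter; first by exists 0.
move=> i j _ _; exists (Num.min i j) => // w [Dw].
by rewrite le_min => /andP[wi wj]; split.
Qed.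

Lemma D_to_ninfty_le g m (P : V -> Prop) :
  (forall x, Dset g x -> level x <= m -> P x) ->
  \forall x \near D_to_ninfty g, P x.
Proof. by move=> H; exists m => // x [Dx xm]; exact: H. Qed.

Lemma joined_mem A z w : joined A z w -> A z.
Proof. by move=> [s [_ _ H]]; apply: H; exact: mem_head. Qed.

End Joined.

Section UpperBound.
Variables (R : realType) (d L : nat) (p : R).
Hypotheses (hd : (1 <= d)%N) (hp : 1 / 2 < p < 1).
Local Notation T := (torus d L).
Local Notation V := (vertex d L).
Variables (W1 W : random_walk d L p).
Implicit Types (g : int -> Defs.fpath d L) (x : V) (s : seq V) (n : nat)
  (lam : R).

(** The value of [Z] when the extension of [g] follows [s]. *)
Definition Zpath g n s : R :=
  lim (cond_prob (walk_prob W1 x)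
    (avoids n%:Z (trace 0 g `|` [set` fend (g 0%R) :: s]))
    (avoids 0 (trace 0 g))
    @[x --> D_to_ninfty g]).

(** When the limit does not exist, [lim] takes the default value 0, which obeys
    the same bounds. *)
Lemma Zpath_bounds g n s (U : R) : Dset g !=set0 -> 0 <= U ->
    (forall x, Dset g x -> level x <= -1 ->
       mass p (hit n%:Z x) x (trace 0 g `|` [set` fend (g 0%R) :: s]) /
       mass p (hit 0 x) x (trace 0 g) <= U) ->
  0 <= Zpath g n s <= U.
Proof.
move=> D0 U0 HU; have PF := D_to_ninfty_proper D0.
rewrite /Zpath; set f := fun x : V => cond_prob _ _ _.
have fE x : level x <= -1 -> f x =
    mass p (hit n%:Z x) x (trace 0 g `|` [set` fend (g 0%R) :: s]) /
    mass p (hit 0 x) x (trace 0 g).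
  by move=> x1; apply: cond_prob_avoids => //; lia.
have [cf|/dvgP ->] := pselect (cvg (f x @[x --> D_to_ninfty g])); last first.
  by have -> : point = 0 :> R by []; rewrite lexx.
apply/andP; split.
  apply: limr_ge => //; apply: (@D_to_ninfty_le _ _ _ (-1)) => x _ /fE ->.
  by rewrite divr_ge0// mass_ge0.
apply: limr_le => //; apply: (@D_to_ninfty_le _ _ _ (-1)) => x Dx x1.
by rewrite fE// HU.
Qed.

Lemma calA_end g : calA 0 g -> level (fend (g 0)) = 0.
Proof. by move=> [/(_ 0 (lexx 0))[]]. Qed.

Lemma expectation_Z g n lam : calA 0 g ->
  ('E_(walk_prob W (fend (g 0%R)))[fun omega => (Z W1 g n omega `^ lam)%R] =
   \esum_(s in [set s | hit n%:Z (fend (g 0%R)) s])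
     (wt p (fend (g 0%R)) s * Zpath g n s `^ lam)%:E)%E.
Proof.
move=> /calA_end g0; rewrite unlock.
apply: (integral_stopped hd hp (W := W) (m := n%:Z) (x := fend (g 0))
  (f := fun omega => Z W1 g n omega `^ lam)
  (phi := fun s => Zpath g n s `^ lam)).
- by rewrite g0.
- by move=> w; exact: powR_ge0.
- by move=> s; exact: powR_ge0.
move=> s w [hs _] fw; congr (_ `^ _); rewrite /Z /Zpath /extended_trace.
by rewrite (stopped_range_follows hs fw).
Qed.

(** Whatever the past, once the second walk has reached level 0 its chances are
    at most the sum over all the sites of that level, and the part of the past
    below level 0 only makes avoidance harder. *)
Lemma q_le_moment n lam x : 0 <= lam ->
  (q W1 W n lam <= (escape_cst d L p lam)%:E * moment p n lam x)%E.
Proof.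
move=> lam0; apply: ge_ereal_sup => _ /= [g [gA D0 _] <-].
rewrite expectation_Z//; have g0 := calA_end gA.
set z := fend (g 0).
have := hit_moment_le hd hp n z lam0.
rewrite g0 add0r (moment_const hd hp _ _ z x).
apply: le_trans; apply: le_esum => s /= hs.
rewrite lee_fin ler_wpM2l ?wt_ge0//.
have U0 : 0 <= \sum_(t : T) mass p (hit n%:Z (0, t)) (0, t) [set` z :: s].
  by apply: sumr_ge0 => t _; exact: mass_ge0.
have /andP[Z0 ZU] : 0 <= Zpath g n s <=
    \sum_(t : T) mass p (hit n%:Z (0, t)) (0, t) [set` z :: s].
  apply: Zpath_bounds D0 U0 _ => x' _ x1.
  rewrite -/z; set K := trace 0 g; set K' := K `|` _.
  have H : mass p (hit n%:Z x') x' K' <= mass p (hit 0 x') x' K *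
      \sum_(t : T) mass p (hit n%:Z (0, t)) (0, t) [set` z :: s].
    apply: (mass_split_le hd hp (m := n%:Z) (m1 := 0)
      (K2 := [set` z :: s])) => //.
    - by apply/andP; split=> //; lia.
    - by move=> s1 _ _; apply: ind_sub => v vs Kv; split=> //; left.
    - by move=> v; right.
    - by apply: sumr_ge0 => t _; exact: mass_ge0.
    move=> s1 h1 _ _; apply: le_trans (mass_hit_le_sum hp _ _ _) _.
    by rewrite (hit_last h1).
  have [->|m0] := eqVneq (mass p (hit 0 x') x' K) 0.
    by rewrite invr0 mulr0; apply: sumr_ge0 => t _; exact: mass_ge0.
  rewrite ler_pdivrMr 1?mulrC//.
  by rewrite lt_neqAle eq_sym m0 mass_ge0.
by rewrite ge0_ler_powR.
Qed.

End UpperBound.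

Section ThickPath.
Variables (d L : nat).
Local Notation T := (torus d L).
Local Notation V := (vertex d L).
Implicit Types (t u : T) (h : seq T) (k : int).

Definition tadj t u := [exists i, (u == turn i t) || (u == turn_back i t)].

Lemma adj_tadj k t u : tadj t u -> adj (k, t) (k, u).
Proof.
move=> /existsP[i iu]; apply/or3P/Or33/existsP; exists i.
by move: iu => /orP[/eqP ->|/eqP ->]; rewrite eqxx ?orbT.
Qed.

Variables (a o : T).
Hypothesis ao : a != o.

Lemma torus_connect t u : t != o -> u != o ->
  exists h, [/\ path tadj t h, last t h = u & o \notin h].
Proof.
move=> to uo.
pose P v := exists h, [/\ path tadj t h, last t h = v & o \notin h].
have step v w : tadj v w -> w != o -> P v -> P w.
  move=> vw wo [h [ph lh oh]]; exists (rcons h w).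
  rewrite rcons_path ph lh last_rcons mem_rcons inE negb_or oh eq_sym wo.
  by split=> //; rewrite vw.
apply: (@torus_minus_point_ind d L o P t u) => //.
- move=> i v _ vo; apply: step => //; apply/existsP; exists i.
  by rewrite eqxx.
- move=> i v _ vo; apply: step => //; apply/existsP; exists i.
  by rewrite eqxx orbT.
- by exists [::].
Qed.

(** Go from [a] to each point in turn and back. *)
Lemma covering_walk : exists h, [/\ path tadj a h, last a h = a, o \notin h
  & forall t, t != o -> t \in a :: h].
Proof.
have [h [ph lh oh H]] : exists h, [/\ path tadj a h, last a h = a, o \notin h
    & forall t, t \in enum T -> t != o -> t \in a :: h].
  elim: (enum T) => [|u r [h [ph lh oh H]]]; first by exists [::].
  have [uo|uo] := eqVneq u o.
    exists h; split=> // t; rewrite inE => /orP[/eqP ->|]; last exact: H.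
    by rewrite uo eqxx.
  have [h1 [p1 l1 o1]] := torus_connect ao uo.
  have [h2 [p2 l2 o2]] := torus_connect uo ao.
  exists (h1 ++ h2 ++ h); split.
  - by rewrite !cat_path p1 l1 p2 l2 ph.
  - by rewrite !last_cat l1 l2.
  - by rewrite !mem_cat !negb_or o1 o2.
  move=> t; rewrite inE => /orP[/eqP -> _|tr to].
    by rewrite -cat_cons mem_cat -l1 mem_last.
  have := H t tr to; rewrite !inE !mem_cat => /orP[->//|->].
  by rewrite !orbT.
by exists h; split=> // t; apply: H; rewrite mem_enum.
Qed.

Variable h : seq T.
Hypotheses (ph : path tadj a h) (lh : last a h = a) (oh : o \notin h)
  (Hh : forall t, t != o -> t \in a :: h).

(** The path that fills every negative level up to the single site of the column
    of [o]: the other walk can only come up that column. *)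
Definition thick_path (j : int) : Defs.fpath d L :=
  ((j - 1, a), [seq (j - 1, t) | t <- h] ++ [:: (j, a)]).

Lemma thick_path_sites j v : v \in fsites (thick_path j) ->
  v = (j, a) \/ v.1 = j - 1 /\ v.2 \in a :: h.
Proof.
rewrite /fsites /= inE mem_cat => /or3P[/eqP ->|/mapP[t th ->]|].
- by right; rewrite mem_head.
- by right; rewrite /= inE th orbT.
- by rewrite inE => /eqP ->; left.
Qed.

Lemma thick_trace v : trace 0 thick_path v <->
  v = (0, a) \/ (level v <= -1 /\ v.2 != o).
Proof.
have ho t : t \in a :: h -> t != o.
  by rewrite inE => /orP[/eqP ->//|th]; apply: contraNneq oh => <-.
split=> [[j j0 /thick_path_sites[->|[v1 /ho v2]]]|].
- have [->|jn0] := eqVneq j 0; first by left.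
  by right; rewrite /level /=; split=> //; lia.
- by right; split=> //; rewrite /level v1; lia.
move=> [->|[v1 v2]].
  by exists 0 => //; rewrite /fsites /= inE mem_cat mem_seq1 eqxx !orbT.
exists (level v + 1); first by lia.
rewrite /fsites /= -cat_cons mem_cat addrK; apply/orP; left.
case: v v1 v2 => k t /= _ /Hh; rewrite !inE => /orP[/eqP ->|th].
  by rewrite eqxx.
by apply/orP; right; exact: map_f.
Qed.

Lemma thick_calA : calA 0 thick_path.
Proof.
split=> j _; last first.
  by rewrite /fend /fstart /= last_cat /= addrK.
split.
- rewrite /= cat_path /= andbT; apply/andP; split.
    elim: h (a) ph => //= t h' IH b /andP[bt ph']; rewrite IH// andbT.
    exact: adj_tadj.
  have -> : last (j - 1, a) [seq (j - 1, t) | t <- h] = (j - 1, a) :> V.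
    by rewrite (last_map (fun t => (j - 1, t) : V)) lh.
  by apply/or3P/Or31; rewrite /step_up /= subrK.
- by [].
- by rewrite /fend /= last_cat.
move=> v; rewrite /= belast_cat /= mem_cat => vs.
have -> : level v = j - 1; last by lia.
have : v \in (j - 1, a) :: [seq (j - 1, t) | t <- h].
  by rewrite lastI mem_rcons inE; move: vs; rewrite mem_seq1 orbC.
by rewrite inE => /orP[/eqP ->//|/mapP[t _ ->]].
Qed.

Lemma column_free k : k <= 0 -> free_sites thick_path (k, o).
Proof.
move=> k0; split=> // /thick_trace[[_ oa]|[_ /=]]; last by rewrite eqxx.
by move: ao; rewrite oa eqxx.
Qed.

Lemma column_joined k : k <= 0 ->
  joined (free_sites thick_path) (k, o) (0, o).
Proof.
move=> k0; exists (upline `|k|%N ((k, o) : V)); split.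
- move: `|k|%N => n; elim: n k {k0} => // n IH k /=; rewrite IH andbT.
  exact/or3P/Or31/eqP.
- have := hit_last (hit_upline `|k|%N ((k, o) : V)).
  have : forall v, v \in (k, o) :: upline `|k|%N ((k, o) : V) -> v.2 = o.
    by move=> v; rewrite inE => /orP[/eqP ->//|/mem_upline[]].
  move=> /(_ _ (mem_last _ _)); case: (last _ _) => k' t' /= ->.
  by rewrite /level /= => ->; congr pair; lia.
move=> v; rewrite inE => /orP[/eqP ->|/mem_upline[vo]].
  exact: column_free.
case: v vo => k' t' /= ->; rewrite /level /= => k'0; apply: column_free.
by lia.
Qed.

Lemma column_Dset k : k <= 0 -> Dset thick_path (k, o).
Proof.
move=> k0; split; first by exists (0, o); split=> //; exact: column_joined.
move=> m; exists (Num.min m 0, o); split.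
  by rewrite /level /= ge_min lexx.
apply: joined_trans (column_joined k0) (joined_sym _); apply: column_joined.
by rewrite ge_min lexx orbT.
Qed.

Lemma thick_Dset_column v : Dset thick_path v -> level v <= -1 -> v.2 = o.
Proof.
move=> [[w [_ /joined_mem[_ nv]]] _] v1; apply/eqP; apply: contra_notT nv => vo.
by apply/thick_trace; right.
Qed.

(** Below level 0 each level of the component is a single site, hence
    connected. *)
Lemma thick_nice : nice thick_path.
Proof.
split; [exact: thick_calA|by exists (0, o); exact: column_Dset|].
move=> n; exists n.+1 => //.
rewrite (@eq_big_nat _ _ _ _ _ _ (fun=> 1%N)) => [|j /andP[j1 _]].
  by rewrite sum_nat_const_nat muln1 subn1.
rewrite asboolT// => z w [Dz zj] [Dw wj].
have zo : z.2 = o by apply: thick_Dset_column; rewrite ?zj//; lia.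
have wo : w.2 = o by apply: thick_Dset_column; rewrite ?wj//; lia.
have -> : w = z.
  case: z w zj wj zo wo {Dz Dw} => [i t] [i' t'].
  by rewrite /level /= => -> -> -> ->.
by exists [::]; split=> // v; rewrite inE => /eqP ->.
Qed.

End ThickPath.

(** * The lower bound, from one nice path *)

Section LowerBound.
Variables (R : realType) (d L : nat) (p : R).
Hypotheses (hd : (1 <= d)%N) (hp : 1 / 2 < p < 1).
Local Notation T := (torus d L).
Local Notation V := (vertex d L).
Variables (W1 W : random_walk d L p).
Implicit Types (x z v w : V) (s : seq V) (n : nat) (lam : R).
Local Notation wt := (wt p).

Lemma trans_up z w : trans p z w != 0 -> level z < level w -> w = step_up z.
Proof.
move=> t0 zw; apply/eqP; apply: contraNT t0 => wz; apply/eqP; rewrite /trans.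
have ne v : level v <= level z -> (w == v) = false.
  by move=> vz; apply: contraTF zw => /eqP ->; rewrite -leNgt.
rewrite (negPf wz) !ne /level //= ?gerBl// !mulr0 !add0r big1// => i _.
by rewrite !ne /level //= addr0 mulr0.
Qed.

Variables (a o : T) (h : seq T).
Hypotheses (ao : a != o) (ph : path (@tadj d L) a h) (lh : last a h = a)
  (oh : o \notin h) (Hh : forall t, t != o -> t \in a :: h).
Let g := thick_path a h.
Let K := trace 0 g.
Let start : V := (0, a).
Let entry : V := (0, o).

Let fend_g : fend (g 0) = start.
Proof. by rewrite /fend /= last_cat. Qed.

Let KP v : K v <-> v = start \/ (level v <= -1 /\ v.2 != o).
Proof. exact: thick_trace. Qed.

(** Below level 0 only the column of [o] is free, so that the walk can reach
    level 0 at a single site. *)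
Let last_entry s x : x.2 = o -> level x < 0 -> wt x s != 0 -> hit 0 x s ->
  (forall v, v \in s -> ~ K v) -> last x s = entry.
Proof.
elim: s x => [|z s IH] x xo x0 /=.
  by move=> _ /eqP xz; rewrite xz ltxx in x0.
rewrite mulf_eq0 negb_or => /andP[xz s0] /andP[_ hs] sK.
have [z0|z0] := ltP (level z) 0.
  apply: IH => //; last by move=> v vs; apply: sK; rewrite inE vs orbT.
  apply/eqP; apply: contra_notT (sK z (mem_head _ _)) => zo.
  by apply/KP; right; split=> //; rewrite -ltzD1.
have zE : z = entry.
  have zup := trans_up xz (lt_le_trans x0 z0).
  have lz : level z = 0 by have := trans_level xz; lia.
  have zo : z.2 = o by rewrite zup.
  by rewrite (surjective_pairing z) zo -/(level z) lz.
by move: hs; rewrite zE; case: (s).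
Qed.

Variable c : R.
Hypothesis c01 : 0 < c <= 1.
Hypothesis detour : forall x y y' : V,
  level y = level x -> level y' = level x -> y != x -> y' != x ->
  exists h : seq V, [/\ last y h = y', all (fun v => level v == level x) h,
    x \notin y :: h & c <= wt y h].

(** From every starting point below level 0 the walk enters level 0 at the same
    site [entry], so that the conditional probability does not depend on the
    starting point and the limit is its common value. *)
Lemma Zpath_ge n s t : rise n start s ->
  c * rise_mass p n (0, t) [set` start :: s] <= Zpath W1 g n s.
Proof.
move=> rs; have s_up v : v \in s -> 0 < level v.
  by move: rs => /andP[_ /allP H] /H.
have PF : ProperFilter (D_to_ninfty g).
  apply: D_to_ninfty_proper; exists entry.
  exact: (column_Dset ao ph oh Hh (lexx 0)).
pose K' := K `|` [set` start :: s].
pose rho := mass p (hit n%:Z entry) entry K'.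
have -> : Zpath W1 g n s = rho.
  apply: lim_near_cst => //; apply: (@D_to_ninfty_le _ _ _ (-1)) => x Dx x1.
  have xo : x.2 = o by exact: (thick_Dset_column ao ph oh Hh Dx x1).
  have x0 : level x < 0 by exact: le_lt_trans x1 _.
  rewrite fend_g (cond_prob_avoids hd hp W1 n (ltW x0)); last by move=> v; left.
  rewrite -/K -/K'.
  have xE : x = (level x, o) by rewrite -xo /level -surjective_pairing.
  have colK : 0 < mass p (hit 0 x) x K.
    have hx : hit 0 x (upline `|level x|%N x).
      have := hit_upline `|level x|%N x.
      by rewrite (_ : level x + _ = 0)//; lia.
    apply: lt_le_trans (mass_ge_term hd hp K (fun s => id) hx).
    rewrite ind_eq1 ?mulr1 ?wt_upline_gt0// => v vx.
    move=> /KP[vE|[_ /eqP]]; last first.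
      by move: vx; rewrite inE => /orP[/eqP ->//|/mem_upline[->]].
    move: vx ao; rewrite vE inE => /orP[/eqP E|/mem_upline[+ _]].
      by rewrite -xo -E eqxx.
    by rewrite /= xo => ->; rewrite eqxx.
  suff -> : mass p (hit n%:Z x) x K' = mass p (hit 0 x) x K * rho.
    by rewrite mulrAC divff ?mul1r ?gt_eqF.
  have lastE s1 : hit 0 x s1 -> wt x s1 != 0 -> ind R K (x :: s1) != 0 ->
      last x s1 = entry.
    move=> h1 w1 /ind_neq0 s1K; apply: last_entry => // v vs.
    by apply: s1K; rewrite inE vs orbT.
  apply/le_anti/andP; split.
    apply: (mass_split_le hd hp (m := n%:Z) (m1 := 0) (K2 := K')).
    - by [].
    - by [].
    - by [].
    - by rewrite ltW.
    - by move=> s1 _ _; apply: ind_sub => v vs Kv; split=> //; left.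
    - by [].
    - exact: mass_ge0.
    - by move=> s1 h1 w1 i1; rewrite (lastE s1 h1 w1 i1); exact: lexx.
  apply: (mass_split_ge hd hp (m := n%:Z) (m1 := 0)
    (S2 := fun v => hit n%:Z v)).
  - by [].
  - by [].
  - by [].
  - by move=> s1 s2 h1 w1; apply: hit_catI w1 (ltW x0) _ h1.
  - move=> s1 h1 w1; apply: ind_sub => v vs [Kv|/= vK']; split => //.
    have v0 : level v <= 0.
      move: vs; rewrite lastI mem_rcons inE => /orP[/eqP ->|vb].
        by rewrite (hit_last h1).
      by apply/ltW/(allP (hit_belast_lt w1 (ltW x0) h1)).
    move: vK'; rewrite inE => /orP[/eqP ->|/s_up]; last by rewrite ltNge v0.
    by apply/KP; left.
  - exact: mass_ge0.
  - by move=> s1 h1 w1 i1; rewrite (lastE s1 h1 w1 i1); exact: lexx.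
apply: (@le_trans _ _ (mass p (climb n entry) entry [set` start :: s])).
  apply: (climb_mass_ge hd hp c01 detour) => //; last by apply/allP => v /s_up.
  by rewrite /entry /start xpair_eqE /= eq_sym.
apply: (mass_le hd hp (m := n%:Z)) => //.
  by move=> t' /climb_hit; rewrite /level /= add0r.
move=> t' /andP[_ /allP up]; apply: ind_sub => v vt vK'; split=> //.
have v0 : 0 <= level v by move: vt; rewrite inE => /orP[/eqP ->//|/up].
move: vK' => [/KP[->|[v1 _]]|//]; first exact: mem_head.
by move: (le_trans v0 v1).
Qed.

Lemma moment_le_q n lam x : 0 <= lam ->
  ((c `^ lam)%:E * moment p n lam x <= (#|T|%:R)%:E * q W1 W n lam)%E.
Proof.
move=> lam0; have [c0 _] := andP c01.
have cl0 : 0 <= c `^ lam by exact: powR_ge0.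
pose E := \esum_(s in [set s | hit n%:Z start s])
  (wt start s * Zpath W1 g n s `^ lam)%:E.
have Eq : (E <= q W1 W n lam)%E.
  apply: ereal_sup_ubound; exists g.
    exact: (thick_nice ao ph lh oh Hh).
  have := expectation_Z hd hp W1 W n lam (thick_calA ao ph lh oh).
  by rewrite fend_g.
apply: le_trans (lee_wpmul2l _ Eq); last by rewrite lee_fin.
rewrite (moment_const hd hp n lam x start) /E.
have term0 s : (0 <= (wt start s * Zpath W1 g n s `^ lam)%:E)%E.
  by rewrite lee_fin mulr_ge0 ?wt_ge0 ?powR_ge0.
rewrite -esumZl//.
pose F s t := wt start s * rise_mass p n (0, t) [set` start :: s] `^ lam.
have F0 s t : 0 <= F s t by rewrite mulr_ge0 ?wt_ge0 ?powR_ge0.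
have -> : moment p n lam start =
    \esum_(s in [set s | rise n start s]) (\sum_t F s t)%:E.
  transitivity (\esum_(s in [set s | rise n start s]) \sum_t (F s t)%:E)%E.
    by rewrite esum_sum// => s t _ _; rewrite lee_fin.
  by apply: eq_esum => s _; rewrite sumEFin.
rewrite -esumZl//; last by move=> s; rewrite lee_fin sumr_ge0.
apply: le_esum_sub => s /=.
  by move=> /rise_hit; rewrite /level /= add0r.
move=> rs; rewrite -!EFinM lee_fin mulr_sumr mulr_natl -sumr_const.
apply: ler_sum => t _; rewrite /F mulrCA ler_wpM2l ?wt_ge0//.
have r0 := rise_mass_ge0 hp n (0, t) [set` start :: s].
have cr0 : 0 <= c * rise_mass p n (0, t) [set` start :: s].
  by rewrite mulr_ge0 ?(ltW c0).
have cZ := Zpath_ge t rs.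
rewrite -powRM ?(ltW c0)// ge0_ler_powR ?nnegrE//.
exact: le_trans cr0 cZ.
Qed.

End LowerBound.

(** Two distinct points on the torus: the component of a nice path meets level 0
    away from the endpoint of the path. *)
Lemma nice_torus (d L : nat) (g : int -> Defs.fpath d L) : nice g ->
  exists t u : torus d L, t != u.
Proof.
move=> [gA [z [[w [w0 zw]] _]] _]; have [_ nw] := joined_mem (joined_sym zw).
exists w.2, (fend (g 0)).2; apply: contra_notN nw => /eqP e.
exists 0 => //; rewrite (_ : w = fend (g 0)) ?/fend ?/fsites ?mem_last//.
have e1 : w.1 = (fend (g 0)).1 by exact: etrans w0 (esym (calA_end gA)).
by rewrite (surjective_pairing w) e e1 -surjective_pairing.
Qed.


Section ExponentBounds.
Variable R : realType.

Lemma powR_le_max (b lam lam2 : R) : 0 <= b -> 0 <= lam <= lam2 ->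
  b `^ lam <= Num.max 1 b `^ lam2.
Proof.
move=> b0 /andP[l0 ll]; apply: (@le_trans _ _ (Num.max 1 b `^ lam)).
  by rewrite ge0_ler_powR ?nnegrE// le_max ?b0 ?ler01 ?lexx ?orbT.
by rewrite ler_powR// le_max lexx.
Qed.

Lemma powR_ge_of_le1 (c lam lam2 : R) : 0 < c <= 1 -> lam <= lam2 ->
  c `^ lam2 <= c `^ lam.
Proof.
move=> /andP[c0 c1] ll; rewrite /powR gt_eqF// ler_expR ler_wnM2r//.
by rewrite ln_le0.
Qed.

(** [u] is multiplicative up to the factor [C ^ 2 / e ^ 2] because [b] is, so
    that [ln u] is almost additive.  The term [u 0] is bounded separately: the
    upper bound on [b (0 + 1)] forces [b 0] to be at least [1 / C]. *)
Lemma almost_multiplicative (u b : nat -> R) (e C N : R) :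
    0 < e -> 0 < C -> (forall n, 0 < b n) -> b 0%N <= N ->
    (forall n, u n <= C * b n) -> (forall n, e * b n <= u n) ->
    (forall n m, b (n + m)%N <= C * (b n * b m)) ->
    (forall n m, (0 < n)%N -> e * (b n * b m) <= b (n + m)%N) ->
  let l := lim (n%:R^-1 * ln (u n) @[n --> \oo]) in
  forall n, Num.min (e ^+ 2 / C ^+ 2) (e / C) * expR (l * n%:R) <= u n /\
            u n <= Num.max (C ^+ 2 / e ^+ 2) (C * N) * expR (l * n%:R).
Proof.
move=> e0 C0 b0 b0N uC ue bC be l.
have u0 n : 0 < u n by apply: lt_le_trans (ue n); rewrite mulr_gt0.
pose A := C ^+ 2 / e ^+ 2.
have A0 : 0 < A by rewrite divr_gt0 ?exprn_gt0.
have AV : e ^+ 2 / C ^+ 2 = A^-1 by rewrite invf_div.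
have bl n : b n <= u n / e by rewrite ler_pdivlMr// mulrC.
have bg n : u n / C <= b n by rewrite ler_pdivrMr// mulrC.
have up n m : u (n + m)%N <= A * (u n * u m).
  apply: le_trans (uC _) _; rewrite /A (_ : _ / _ * _ =
    C * (C * (u n / e * (u m / e)))); last by field; rewrite gt_eqF.
  rewrite ler_wpM2l ?(ltW C0)//; apply: le_trans (bC _ _) _.
  by rewrite ler_wpM2l ?(ltW C0)// ler_pM ?(ltW (b0 _)).
have low n m : (0 < n)%N -> A^-1 * (u n * u m) <= u (n + m)%N.
  move=> n0; apply: le_trans (ue _); rewrite -AV (_ : _ / _ * _ =
    e * (e * (u n / C * (u m / C)))); last by field; rewrite gt_eqF.
  rewrite ler_wpM2l ?(ltW e0)//; apply: le_trans (be _ _ n0).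
  by rewrite ler_wpM2l ?(ltW e0)// ler_pM ?divr_ge0 ?(ltW (u0 _)) ?(ltW C0).
have uD n m : (0 < n)%N -> (0 < m)%N ->
    `|ln (u (n + m)%N) - ln (u n) - ln (u m)| <= ln A.
  move=> n0 _.
  have uu0 : 0 < u n * u m by rewrite mulr_gt0.
  have A0V : 0 < A^-1 by rewrite invr_gt0.
  have lnAu (r : R) : 0 < r ->
      ln (r * (u n * u m)) = ln r + (ln (u n) + ln (u m)).
    by move=> r0; rewrite lnM ?lnM ?posrE ?mulr_gt0 ?u0.
  have hi : ln (u (n + m)%N) <= ln (A * (u n * u m)).
    by rewrite ler_ln ?posrE ?(mulr_gt0 A0 uu0) ?up.
  have lo : ln (A^-1 * (u n * u m)) <= ln (u (n + m)%N).
    by rewrite ler_ln ?posrE ?(mulr_gt0 A0V uu0) ?low.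
  move: hi lo; rewrite !lnAu ?invr_gt0// lnV ?posrE// => hi lo.
  by rewrite ler_norml; apply/andP; split; lra.
case=> [|n].
  rewrite mulr0 expR0 !mulr1; split.
    apply: le_trans (ue 0%N); apply: (@le_trans _ _ (e / C)).
      by rewrite ge_min lexx orbT.
    rewrite ler_pM2l// -[leLHS]mul1r ler_pdivrMr//.
    have := bC 0%N 1%N; rewrite add0n mulrA -[leLHS]mul1r ler_pM2r//.
    by rewrite mulrC.
  apply: le_trans (uC 0%N) _; rewrite le_max ler_wpM2l ?orbT//.
  exact: ltW.
have := almost_additive_lim uD (ltn0Sn n); rewrite -/l.
rewrite ler_norml => /andP[lo hi].
have uE : u n.+1 = expR (ln (u n.+1)) by rewrite lnK ?posrE.
split.
  apply: (@le_trans _ _ (A^-1 * expR (l * n.+1%:R))).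
    by rewrite ler_wpM2r ?expR_ge0// -AV ge_min lexx.
  rewrite uE -[A^-1]lnK ?posrE ?invr_gt0// -expRD ler_expR lnV ?posrE//.
  by move: lo; rewrite mulrC; lra.
apply: (@le_trans _ _ (A * expR (l * n.+1%:R))).
  rewrite uE -[X in X * _]lnK ?posrE// -expRD ler_expR.
  by move: hi; rewrite mulrC; lra.
by rewrite ler_wpM2r ?expR_ge0// le_max lexx.
Qed.

End ExponentBounds.

(** * Conclusion *)

Theorem proposition2p7 (R : realType) (d L : nat) (p : R)
    (hd : (1 <= d)%N) (hL : (1 <= L)%N) (hp : 1 / 2 < p < 1)
    (hnice : @nice d L !=set0)
    (W1 W : random_walk d L p)
    (lambda1 lambda2 : R) (hlambda1 : 0 < lambda1)
    (hlambda2 : lambda1 < lambda2) :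
  exists c1 c2 : R,
    [/\ 0 < c1, 0 < c2
      & forall (n : nat) (lambda : R), lambda1 <= lambda <= lambda2 ->
          ((c1 * expR (- xi W1 W lambda * n%:R))%:E <= q W1 W n lambda)%E /\
          (q W1 W n lambda <= (c2 * expR (- xi W1 W lambda * n%:R))%:E)%E].
Proof.
have [g /nice_torus[a [t ta]]] := hnice.
have [h [ph lh oh Hh]] := covering_walk ta.
have [c c01 detour] := sidestep L hd hp.
have [c0 _] := andP c01.
pose N : R := #|torus d L|%:R.
have N0 : 0 < N by rewrite ltr0n; apply/card_gt0P; exists a.
pose G := green d p; have G0 : 0 < G by exact: green_gt0.
pose B := Num.max 1 (N * G * N).
pose C := G * (B `^ lambda2 * N).
pose e := c `^ lambda2 / N.
have B0 : 0 < B by rewrite lt_max ltr01.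
have C0 : 0 < C by apply: mulr_gt0 G0 _; apply: mulr_gt0 => //; exact: powR_gt0.
have e0 : 0 < e by apply: divr_gt0 => //; exact: powR_gt0.
exists (Num.min (e ^+ 2 / C ^+ 2) (e / C)), (Num.max (C ^+ 2 / e ^+ 2) (C * N)).
split.
- rewrite lt_min (divr_gt0 (exprn_gt0 2 e0) (exprn_gt0 2 C0)).
  exact: divr_gt0 e0 C0.
- by rewrite lt_max (divr_gt0 (exprn_gt0 2 C0) (exprn_gt0 2 e0)).
move=> n lam /andP[l1 l2].
have lam0 : 0 <= lam by exact: le_trans (ltW hlambda1) l1.
pose x : vertex d L := (0, a).
pose b k := fine (moment p k lam x).
have bE k : moment p k lam x = (b k)%:E.
  by rewrite fineK//; exact: moment_fin.
have b0 k : 0 < b k.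
  rewrite -lte_fin -bE; apply: (moment_gt0 hd hp _ _ (x := x) (t := t)).
  by rewrite eq_sym.
have bN k : b k <= N by rewrite -lee_fin -bE; exact: moment_le.
have CE : escape_cst d L p lam <= C.
  apply: ler_wpM2l; first exact: ltW.
  apply: ler_wpM2r; first exact: ltW.
  apply: powR_le_max; last by rewrite lam0.
  by apply: mulr_ge0 (ltW N0); apply: mulr_ge0 (ltW N0) (ltW G0).
have eE : e <= c `^ lam / N.
  by rewrite ler_pM2r ?invr_gt0//; exact: powR_ge_of_le1.
have qC k : (q W1 W k lam <= (C * b k)%:E)%E.
  apply: le_trans (q_le_moment hd hp W1 W k x lam0) _.
  by rewrite bE -EFinM lee_fin ler_pM2r.
have qe k : ((e * b k)%:E <= q W1 W k lam)%E.
  have := moment_le_q hd hp W1 W ta ph lh oh Hh c01 detour k x lam0.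
  rewrite bE -EFinM -lee_pdivrMl// -EFinM; apply: le_trans.
  by rewrite lee_fin mulrA ler_pM2r// mulrC.
have qE k : q W1 W k lam = (fine (q W1 W k lam))%:E.
  rewrite fineK// fin_real//; apply/andP; split.
    by apply: lt_le_trans (qe k); rewrite ltNyr.
  by apply: le_lt_trans (qC k) _; rewrite ltry.
have bC k m : b (k + m)%N <= C * (b k * b m).
  have := moment_add_le hd hp k m x lam0; rewrite !bE -!EFinM lee_fin.
  by move=> /le_trans; apply; rewrite ler_pM2r ?(mulr_gt0 (b0 k) (b0 m)).
have be k m : (0 < k)%N -> e * (b k * b m) <= b (k + m)%N.
  move=> k0; have := moment_add_ge hd hp c01 detour m x k0 lam0.
  rewrite !bE -!EFinM lee_fin -ler_pdivrMl//; apply: le_trans.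
  by rewrite [leRHS]mulrA (mulrC N^-1) ler_pM2r ?(mulr_gt0 (b0 k) (b0 m)).
have uC k : fine (q W1 W k lam) <= C * b k by rewrite -lee_fin -qE.
have ue k : e * b k <= fine (q W1 W k lam) by rewrite -lee_fin -qE.
have := almost_multiplicative e0 C0 b0 (bN 0%N) uC ue bC be n.
have -> : - xi W1 W lam = lim (k%:R^-1 * ln (fine (q W1 W k lam)) @[k --> \oo]).
  by rewrite /xi opprK.
by rewrite [q W1 W n lam]qE !lee_fin.
Qed.
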